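(* Let $\Omega\subset\mathbb{R}^n$ be open, let $1<p<\infty$ and $\tau>0$, and let $Q$ be a measurable function on $\Omega$ with values in the symmetric positive semi-definite $n\times n$ matrices such that $Q\in L^{\frac p2}_{\mathrm{loc}}(\Omega)$. Then for every open set $\Theta\Subset\Omega$ and every $\varphi\in L^{p'}(\Theta)$, the Dirichlet problem $$\operatorname{div}\big(|\sqrt Q\nabla u|^{p-2}Q\nabla u\big)-\tau|u|^{p-2}u=\varphi\ \text{ in }\Theta,\qquad u=0\ \text{ on }\partial\Theta,$$ has a weak solution $\vec{\mathbf u}=(u,\vec g)\in\widehat H^{1,p}_{Q,0}(\Theta)$.
   Context: $p'=p/(p-1)$. $|Q(x)|_{\mathrm{op}}=\sup_{|\xi|=1}|Q(x)\xi|$ and $Q\in L^{r}_{\mathrm{loc}}$ means $|Q|_{\mathrm{op}}\in L^r_{\mathrm{loc}}$; $\sqrt Q$ is the positive semi-definite square root. $\Theta\Subset\Omega$ means $\Theta$ bounded and $\overline\Theta\subset\Omega$; $Lip_0(\Theta)$ is the set of Lipschitz functions $f$ with $\operatorname{supp}(f)\Subset\Theta$. $\mathcal L^p_Q(\Theta)$ is the space of measurable $\mathbf f:\Theta\to\mathbb{R}^n$ with $\|\mathbf f\|_{\mathcal L^p_Q(\Theta)}=(\int_\Theta|\sqrt Q\mathbf f|^p\,dx)^{1/p}<\infty$, modulo $\mathbf f\equiv\mathbf g$ iff $\|\mathbf f-\mathbf g\|_{\mathcal L^p_Q(\Theta)}=0$. The degenerate Sobolev space $\widehat H^{1,p}_{Q,0}(\Theta)$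 is the formal closure (completion) of $Lip_0(\Theta)$ under the norm $\|f\|=\big[\int_\Theta|f|^p\,dx+\int_\Theta|\sqrt Q\nabla f|^p\,dx\big]^{1/p}$; its elements are represented by pairs $(u,\vec g)\in L^p(\Theta)\times\mathcal L^p_Q(\Theta)$, i.e. it is identified with the closure of $\{(f,\nabla f):f\in Lip_0(\Theta)\}$ in $L^p(\Theta)\times\mathcal L^p_Q(\Theta)$ with norm $(\|u\|_{L^p}^p+\|\vec g\|_{\mathcal L^p_Q}^p)^{1/p}$. A weak solution of the Dirichlet problem is an element $\vec{\mathbf u}=(u,\vec g)\in\widehat H^{1,p}_{Q,0}(\Theta)$ such that for every $v\in Lip_0(\Theta)$, $$\int_\Theta\langle Q\vec g,\vec g\rangle^{\frac{p-2}2}\langle Q\vec g,\nabla v\rangle\,dx+\tau\int_\Theta|u|^{p-2}uv\,dx=-\int_\Theta\varphi v\,dx,$$ where for $1<p<2$ the integrands are taken to be $0$ at points where $\sqrt Q\vec g=0$, respectively $u=0$. *)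

(* Defs.v *)
From HB Require Import structures.
From mathcomp Require Import all_boot all_order all_algebra.
From mathcomp Require Import all_classical all_reals all_analysis.

Set Implicit Arguments.
Unset Strict Implicit.
Unset Printing Implicit Defensive.

Import Order.TTheory GRing.Theory Num.Theory.
Import numFieldNormedType.Exports.

Local Open Scope classical_set_scope.
Local Open Scope ring_scope.

(* Points and vectors of R^n are row vectors 'rV[R]_n. A matrix acts on them   *)
(* from the right: for a symmetric matrix A, the vector A xi is xi *m A.       *)

Definition measure_row_display : measure_display.
Proof. exact: default_measure_display. Qed.

Section borel_row.
Context (R : realType) (n : nat).

Let coors : 'I_n -> 'rV[R]_n -> measurableTypeR R := fun i x => x ord0 i.

Let row_set0 : g_sigma_preimage coors set0.
Proof. exact: sigma_algebra0. Qed.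

Let row_setC A : g_sigma_preimage coors A -> g_sigma_preimage coors (~` A).
Proof. exact: sigma_algebraC. Qed.

Let row_bigcup (F : _^nat) : (forall i, g_sigma_preimage coors (F i)) ->
  g_sigma_preimage coors (\bigcup_i (F i)).
Proof. exact: sigma_algebra_bigcup. Qed.

(* The sigma-algebra generated by the coordinates, i.e. the Borel sets of R^n. *)
HB.instance Definition _ := @isMeasurable.Build measure_row_display
  'rV[R]_n (g_sigma_preimage coors) row_set0 row_setC row_bigcup.

Lemma measurable_coor (i : 'I_n) :
  measurable_fun [set: 'rV[R]_n] (fun x => x ord0 i : measurableTypeR R).
Proof.
move=> _ Y mY; rewrite setTI; apply: sub_sigma_algebra => /=.
rewrite -bigcup_seq/=; exists i => /=; first by rewrite mem_index_enum.
by exists Y => //; rewrite setTI.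
Qed.

Lemma measurable_row d (T : measurableType d) (f : T -> 'rV[R]_n) :
  (forall i, measurable_fun setT (fun t => f t ord0 i : measurableTypeR R)) ->
  measurable_fun setT f.
Proof.
move=> mf _ A mA; rewrite setTI.
suff : g_sigma_preimage coors `<=` [set B | measurable (f @^-1` B)] by exact.
apply: smallest_sub.
  split => [|B mB|F mF].
  - by rewrite /= preimage_set0; exact: measurable0.
  - by rewrite /= setTD; exact: measurableC.
  - by rewrite /= preimage_bigcup; apply: bigcup_measurable => k _; exact: mF.
rewrite -bigcup_seq => _ [i _ [C mC <-]] /=.
have := mf i measurableT C mC; rewrite !setTI; exact.
Qed.

End borel_row.

Section borel_measure_step.
Context (R : realType) (n : nat).

Definition cons_row (x : measurableTypeR R * 'rV[R]_n) : 'rV[R]_n.+1 :=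
  row_mx (x.1 : R)%:M x.2.

Definition uncons_row (x : 'rV[R]_n.+1) : measurableTypeR R * 'rV[R]_n :=
  (x ord0 ord0, @rsubmx _ 1 1 n x).

Lemma cons_row0 x : cons_row x ord0 ord0 = x.1.
Proof.
rewrite [LHS](_ : _ = row_mx (x.1 : R)%:M x.2 ord0 (lshift n ord0)).
  by rewrite row_mxEl mxE.
by congr (row_mx _ _ _ _); exact: val_inj.
Qed.

Lemma cons_rowS x i : cons_row x ord0 (lift ord0 i) = x.2 ord0 i.
Proof.
rewrite [LHS](_ : _ = row_mx (x.1 : R)%:M x.2 ord0 (rshift 1 i)).
  by rewrite row_mxEr.
by congr (row_mx _ _ _ _); exact: val_inj.
Qed.

Lemma cons_rowK : cancel cons_row uncons_row.
Proof.
by move=> [a v]; rewrite /uncons_row cons_row0 /cons_row row_mxKr.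
Qed.

Lemma measurable_cons_row : measurable_fun setT cons_row.
Proof.
apply: measurable_row => i; have [j ->|->] := unliftP ord0 i.
  under eq_fun do rewrite cons_rowS.
  exact: (measurableT_comp (measurable_coor j) measurable_snd).
under eq_fun do rewrite cons_row0.
exact: measurable_fst.
Qed.

Lemma measurable_uncons_row : measurable_fun setT uncons_row.
Proof.
apply/measurable_fun_pairP; split => /=; first exact: measurable_coor.
apply: measurable_row => i.
rewrite (_ : (fun _ => _) =
  fun x : 'rV[R]_n.+1 => x ord0 (rshift 1 i) : measurableTypeR R).
  exact: (@measurable_coor R n.+1 (rshift 1 i)).
by apply/funext => x; rewrite /= mxE.
Qed.

Variable m : {sigma_finite_measure set 'rV[R]_n -> \bar R}.

Definition borel_measure_step : set 'rV[R]_n.+1 -> \bar R :=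
  pushforward (lebesgue_measure \x m)%E cons_row.

Let step0 : borel_measure_step set0 = 0%E.
Proof. by rewrite /borel_measure_step/pushforward preimage_set0 measure0. Qed.

Let step_ge0 A : (0 <= borel_measure_step A)%E.
Proof. by rewrite /borel_measure_step/pushforward; apply: measure_ge0. Qed.

Let step_sigma_additive : semi_sigma_additive borel_measure_step.
Proof.
move=> F mF tF mUF; rewrite /borel_measure_step/pushforward preimage_bigcup.
apply: measure_semi_sigma_additive.
- by move=> k; rewrite -[X in measurable X]setTI; exact: measurable_cons_row.
- apply/trivIsetP => /= i j _ _ ij; rewrite -preimage_setI.
  by move/trivIsetP : tF => /(_ _ _ _ _ ij) ->//; rewrite preimage_set0.
- rewrite -preimage_bigcup -[X in measurable X]setTI.
  exact: measurable_cons_row.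
Qed.

HB.instance Definition _ := isMeasure.Build _ _ _ borel_measure_step
  step0 step_ge0 step_sigma_additive.

Let borel_measure_step_sigma_finite : sigma_finite setT borel_measure_step.
Proof.
have /sigma_finiteP[F [FT ndF Foo]] := sigma_finiteT (@lebesgue_measure R).
have /sigma_finiteP[G [GT ndG Goo]] := sigma_finiteT m.
exists (fun k => uncons_row @^-1` (F k `*` G k)).
  apply/esym; rewrite -subTset => x _.
  have [k _ Fk] : (\bigcup_k F k) (uncons_row x).1 by rewrite -FT.
  have [l _ Gl] : (\bigcup_k G k) (uncons_row x).2 by rewrite -GT.
  exists (maxn k l) => //; split.
  - by move: Fk; exact/subsetPset/ndF/leq_maxl.
  - by move: Gl; exact/subsetPset/ndG/leq_maxr.
move=> k; have [mF Fk] := Foo k; have [mG Gk] := Goo k; split.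
  by rewrite -[X in measurable X]setTI; apply: measurable_uncons_row => //;
    exact: measurableX.
rewrite /borel_measure_step /pushforward (_ : _ @^-1` _ = F k `*` G k).
  by rewrite product_measure1E// lte_mul_pinfty// ge0_fin_numE.
by rewrite -comp_preimage (_ : _ \o _ = id) //; apply/funext/cons_rowK.
Qed.

HB.instance Definition _ := Measure_isSigmaFinite.Build _ _ _
  borel_measure_step borel_measure_step_sigma_finite.

End borel_measure_step.

(* Lebesgue measure on the Borel sets of R^n, as an iterated product. *)
Fixpoint borel_measure (R : realType) (n : nat) :
    {sigma_finite_measure set 'rV[R]_n -> \bar R} :=
  match n with
  | 0 => dirac (0 : 'rV[R]_0)
  | n'.+1 => borel_measure_step (borel_measure R n')
  end.

Arguments borel_measure : clear implicits.

Definition box (R : realType) (n : nat) (a b : 'rV[R]_n) : set 'rV[R]_n :=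
  [set x | forall i, x ord0 i \in `]a ord0 i, b ord0 i]].

Lemma measurable_box (R : realType) n (a b : 'rV[R]_n) : measurable (box a b).
Proof.
rewrite (_ : box a b = \bigcap_(i in [set: 'I_n])
  [set x : 'rV[R]_n | x ord0 i \in `]a ord0 i, b ord0 i]]).
  apply: fin_bigcap_measurable => // i _.
  have := @measurable_coor R n i measurableT `]a ord0 i, b ord0 i]%classic
    (measurable_itv _).
  by rewrite setTI.
by apply/seteqP; split => [x xab i _|x xab i]; [exact: xab|exact: xab].
Qed.

Lemma borel_box (R : realType) n (a b : 'rV[R]_n) :
  (forall i, a ord0 i <= b ord0 i) ->
  borel_measure R n (box a b) = (\prod_i (b ord0 i - a ord0 i))%:E.
Proof.
elim: n a b => [|n IH] a b ab.
  rewrite big_ord0 /= diracE mem_set//; by case.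
rewrite /= /borel_measure_step /pushforward.
pose a' : 'rV[R]_n := \row_i a ord0 (lift ord0 i).
pose b' : 'rV[R]_n := \row_i b ord0 (lift ord0 i).
rewrite (_ : _ @^-1` _ = `]a ord0 ord0, b ord0 ord0]%classic `*` box a' b').
  rewrite product_measure1E//; last exact: measurable_box.
  rewrite big_ord_recl EFinM; congr (_ * _)%E.
    rewrite /= lebesgue_measure_itv/= lte_fin.
    case: ltP => // ba; have /eqP -> : a ord0 ord0 == b ord0 ord0.
      by rewrite eq_le ab ba.
    by rewrite subrr.
  by rewrite IH => [|i]; [congr (_%:E); apply: eq_bigr => i _|]; rewrite !mxE.
apply/seteqP; split => [x /= xab|x /= [x0 xab] i].
  split; first by have := xab ord0; rewrite cons_row0.
  by move=> i; have := xab (lift ord0 i); rewrite cons_rowS !mxE.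
have [j ->|->] := unliftP ord0 i; last by rewrite cons_row0.
by have := xab j; rewrite cons_rowS !mxE.
Qed.

(* R^n with the sigma-algebra of Lebesgue measurable sets. *)
Definition lebesgue_row (R : realType) (n : nat) :=
  caratheodory_type ((borel_measure R n)^*)%mu.

Definition lebesgue (R : realType) (n : nat) :
    {measure set (lebesgue_row R n) -> \bar R} :=
  @completed_measure_extension _ _ _ (borel_measure R n).

Arguments lebesgue {R n}.

Lemma lebesgue_box (R : realType) n (a b : 'rV[R]_n) :
  (forall i, a ord0 i <= b ord0 i) ->
  @lebesgue R n (box a b) = (\prod_i (b ord0 i - a ord0 i))%:E.
Proof.
move=> ab; rewrite -borel_box// /lebesgue /= /completed_measure_extension.
apply: measurable_mu_extE; exact: measurable_box.
Qed.

Section degenerate_p_laplacian.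
Context {R : realType} {n : nat}.

Implicit Types (p tau : R) (x xi eta : 'rV[R]_n) (A : 'M[R]_n).
Implicit Types (D Theta Omega : set 'rV[R]_n) (Q : 'rV[R]_n -> 'M[R]_n).

Definition inner xi eta : R := \sum_i xi ord0 i * eta ord0 i.

(* The canonical norm of 'rV[R]_n is the sup norm. *)
Definition enorm xi : R := Num.sqrt (inner xi xi).

Definition psd A : Prop := A^T = A /\ forall xi, 0 <= inner (xi *m A) xi.

Definition op_norm A : R :=
  sup [set enorm (xi *m A) | xi in [set xi | enorm xi = 1]].

Definition sqrt_mx A : 'M[R]_n :=
  xget 0 [set B : 'M[R]_n | psd B /\ B *m B = A].

Definition compactly_included Theta Omega : Prop :=
  bounded_set Theta /\ closure Theta `<=` Omega.

Definition Lp_norm p D (f : 'rV[R]_n -> R) : \bar R :=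
  ((\int[lebesgue]_(x in D) (`|f x| `^ p)%:E) `^ p^-1)%E.

Definition mem_Lp p D (f : 'rV[R]_n -> R) : Prop :=
  measurable_fun (D : set (lebesgue_row R n)) f /\
  (Lp_norm p D f < +oo)%E.

Definition mem_Lp_loc p D (f : 'rV[R]_n -> R) : Prop :=
  forall K, compact K -> K `<=` D -> mem_Lp p K f.

Definition LpQ_norm p Q D (g : 'rV[R]_n -> 'rV[R]_n) : \bar R :=
  ((\int[lebesgue]_(x in D) (enorm (g x *m sqrt_mx (Q x)) `^ p)%:E) `^ p^-1)%E.

Definition mem_LpQ p Q D (g : 'rV[R]_n -> 'rV[R]_n) : Prop :=
  (forall i, measurable_fun (D : set (lebesgue_row R n))
     (fun x => g x ord0 i)) /\
  (LpQ_norm p Q D g < +oo)%E.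

(* 'D_v f x is a total function; by Rademacher's theorem the partial          *)
(* derivatives of a Lipschitz function exist almost everywhere.               *)
Definition grad (f : 'rV[R]_n -> R) (x : 'rV[R]_n) : 'rV[R]_n :=
  \row_i 'D_(delta_mx ord0 i) f x.

(* A function of Lip_0(Theta) is extended by 0 to R^n. *)
Definition Lip0 Theta (f : 'rV[R]_n -> R) : Prop :=
  lipschitz f /\ compactly_included (closure [set x | f x != 0]) Theta.

Definition pair_norm p Q Theta u g : \bar R :=
  ((Lp_norm p Theta u `^ p + LpQ_norm p Q Theta g `^ p) `^ p^-1)%E.

(* Elements of the spaces L^p, L^p_Q and H^{1,p}_{Q,0} are given by           *)
(* representatives; none of the conditions depends on their choice.           *)
Definition mem_H1pQ0 p Q Theta (u : 'rV[R]_n -> R)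
    (g : 'rV[R]_n -> 'rV[R]_n) : Prop :=
  [/\ mem_Lp p Theta u, mem_LpQ p Q Theta g &
    forall e : R, 0 < e -> exists2 f, Lip0 Theta f &
      (pair_norm p Q Theta (u \- f)%R (g \- grad f)%R < e%:E)%E].

(* For 1 < p < 2, 0 `^ (p - 2) = 0 in powR, so the integrands vanish where    *)
(* sqrt Q g = 0, respectively u = 0. When |Q|_op is in L^{p/2}_loc(Omega)     *)
(* with Theta compactly included in Omega, and phi in L^{p'}(Theta), all three *)
(* integrals are absolutely convergent by Hoelder's inequality.               *)
Definition weak_solution p tau Q Theta (phi : 'rV[R]_n -> R)
    (u : 'rV[R]_n -> R) (g : 'rV[R]_n -> 'rV[R]_n) : Prop :=
  mem_H1pQ0 p Q Theta u g /\
  forall v, Lip0 Theta v ->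
    \int[lebesgue]_(x in Theta)
      (inner (g x *m Q x) (g x) `^ ((p - 2) / 2)
         * inner (g x *m Q x) (grad v x)) +
    tau * \int[lebesgue]_(x in Theta) (`|u x| `^ (p - 2) * u x * v x) =
    - \int[lebesgue]_(x in Theta) (phi x * v x).

End degenerate_p_laplacian.

(* Main.v *)
(* The direct method: a weak solution is a minimizer of the strictly convex    *)
(* functional J(u, g) = (1/p) int (tau |u|^p + |sqrt Q g|^p) + int phi u over  *)
(* the closure of the pairs (f, grad f), f Lipschitz. Uniform convexity of     *)
(* t |-> t^p makes minimizing sequences Cauchy. A limit in L^p_Q exists even   *)
(* where Q degenerates: a measurable Gram-Schmidt process with respect to      *)
(* Q(x) reduces completeness to convergence of scalar coefficients. Dominated  *)
(* convergence of difference quotients then gives the Euler-Lagrange equation. *)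
(* Rademacher's theorem is needed only for partial derivatives: on a line,     *)
(* x |-> f x + K x is nondecreasing, its Stieltjes measure has a density by    *)
(* Radon-Nikodym, and Lebesgue differentiation applies; Fubini does the rest.  *)

Require Import Defs.
From HB Require Import structures.
From mathcomp Require Import all_boot all_order all_algebra.
From mathcomp Require Import all_classical all_reals all_analysis.
From mathcomp Require Import spectral complex.
From mathcomp Require Import measurable_realfun ring lra.

Set Implicit Arguments.
Unset Strict Implicit.
Unset Printing Implicit Defensive.

Import Order.TTheory GRing.Theory Num.Theory.
Import numFieldNormedType.Exports.

Local Open Scope classical_set_scope.
Local Open Scope ring_scope.

(** * Lipschitz functions *)

(** The equation is the Euler-Lagrange equation of the [functional] J(u, g) = E(u, g)/p + int phi u,
    where the energy E integrates tau |u|^p + |sqrt Q g|^p. The competitors are the pairs (f, grad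
    f) with f in [Lip0]. They have finite energy because partial derivatives of a Lipschitz function
    exist almost everywhere and are bounded, and |Q|_op^(p/2) is integrable on Theta
    ([grad_energy_integrable]). Young's inequality bounds E by J ([functional_coercive]), so J has
    an infimum m over the competitors. The midpoint of two almost minimal competitors is again a
    competitor, so its J is at least m. As the load is linear, the defect of convexity of E at the
    midpoint is then small, and [energy_uniform_convexity] converts a small defect into a small
    energy of the difference. Minimizing sequences are therefore Cauchy ([minimizing_cauchy]). The
    pointwise convexity inequality rests on the parallelogram law for the semidefinite form Q(x) and
    on the strict convexity of t^p, and treats all p > 1 at once. Completeness
    ([total_energy_complete]) is a Riesz-Fischer argument. Where Q(x) degenerates, the coordinates
    of g_k need not converge; its coefficients along fields that are orthogonal for Q(x) do, and
    [gram_schmidt] produces such fields measurably. The scalar u is handled by the same lemmas, as a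
    vector of length 1 with the identity matrix. The limit w lies in the closure of the competitors
    and satisfies J(w) <= m <= J(w + t v) for every competitor v. The difference quotients in t
    converge under the integral, with a majorant provided by convexity ([qnorm_quotient_le]); this
    gives weak form plus load >= 0, and replacing v by -v gives the equation ([euler_lagrange]). *)

Section lipschitz_line.
Context {R : realType}.
Local Notation mu := (@lebesgue_measure R).

(** A half-open interval has Stieltjes mass at most [|K| + 1] times its length, so a cover of [A] of
    small total length is also a cover of small total mass. The constant [|K| + 1] is used because
    it is positive whatever the sign of [K]. *)
Lemma lebesgue_stieltjes_dominated (G : cumulative R R) (K : R) :
  (forall x y, x <= y -> G y - G x <= K * (y - x)) ->
  lebesgue_stieltjes_measure G `<< mu.
Proof.
move=> GK; apply/null_content_dominatesP => A mA muA0.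
have K1 : 0 < `|K| + 1 by rewrite ltr_pwDr.
apply/eqP; rewrite eq_le measure_ge0 andbT; apply/lee_addgt0Pr => e e0.
rewrite add0e.
have : (mu A < (e / (`|K| + 1))%:E)%E by rewrite muA0 lte_fin divr_gt0.
move=> /ereal_inf_lt[_ [F [mF AF] <-] FE].
have : (lebesgue_stieltjes_measure G A <=
    \sum_(k <oo) wlength G (F k))%E.
  by apply: ereal_inf_lbound; exists F.
move=> /le_trans; apply.
apply: (@le_trans _ _ (\sum_(k <oo) ((`|K| + 1)%:E * wlength idfun (F k)))%E).
  apply: lee_nneseries => [i _ _|i _]; first exact: wlength_ge0.
  have [|[[a b] /= ab ->]] := (ocitvP (F i)).1 (mF i).
    by move=> ->; rewrite !wlength0 mule0.
  rewrite !wlength_itv_bnd; [|exact: ltW..].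
  rewrite -EFinM lee_fin /=.
  rewrite (le_trans (GK _ _ (ltW ab)))// ler_pM2r ?subr_gt0//.
  by rewrite (le_trans (ler_norm _))// lerDl.
rewrite nneseriesZl; last by move=> i _; exact: wlength_ge0.
by rewrite -lee_pdivlMl// (le_trans (ltW FE))// lee_fin mulrC.
Qed.

(** On a bounded window the Stieltjes measure of [G] is finite and absolutely continuous, hence has
    a density by Radon-Nikodym. There [G] differs by a constant from the indefinite integral of this
    density, which is derivable almost everywhere by Lebesgue differentiation. *)
Lemma nd_lipschitz_derivable (G : cumulative R R) (K : R) :
  (forall x y, x <= y -> G y - G x <= K * (y - x)) ->
  {ae mu, forall x, derivable G x 1}.
Proof.
move=> GK.
suff H (N : nat) : {ae mu, forall x, - N%:R < x < N%:R -> derivable G x 1}.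
  have := ae_foralln H; apply: filterS => x h.
  have [] := (@archi_boundP _ `|x| (normr_ge0 _)).
  by move=> xN; apply: (h (Num.bound `|x|)); rewrite -ltr_norml.
pose D : set (measurableTypeR R) := `]- N%:R, N%:R]%classic.
have mD : measurable D by exact: measurable_itv.
have nuE x y : x <= y -> lebesgue_stieltjes_measure G `]x, y]%classic =
    (G y - G x)%:E.
  move=> xy; rewrite /lebesgue_stieltjes_measure /measure_extension.
  rewrite measurable_mu_extE; last exact: is_ocitv.
  exact: wlength_itv_bnd.
have NN : - N%:R <= N%:R :> R by rewrite (@le_trans _ _ 0)// oppr_le0.
have nuD : (lebesgue_stieltjes_measure G D < +oo)%E by rewrite nuE// ltry.
pose nu := mfrestr mD nuD : {finite_measure set _ -> \bar R}.
have numu : nu `<< mu.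
  have /null_content_dominatesP dom := lebesgue_stieltjes_dominated GK.
  apply/null_content_dominatesP => A mA muA.
  rewrite /nu/= /mfrestr /mrestr; apply: dom; first exact: measurableI.
  by apply: (subset_measure0 _ _ _ muA); [exact: measurableI|exact: mA|apply: subIsetl].
have [h [h0 hfin ih hE]] := @radon_nikodym_sigma_finite _ _ _ mu nu numu.
pose f := fine \o h.
have fE : EFin \o f = h by apply/funext => x; rewrite /f /= fineK.
have if_ : mu.-integrable setT (EFin \o f) by rewrite fE.
have := @FTC1 R f (BRight (- N%:R)).
have if2 y : mu.-integrable [set` Interval (BRight (- N%:R)) (BRight y)] (EFin \o f).
  by apply: integrableS if_ => //; exact: measurable_itv.
move=> /(_ if2 (open_integrable_locally openT if_)).
apply: filterS; first exact: (ae_filter_ringOfSetsType mu).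
move=> x /= H /andP[Nx xN]; have [+ _] := H Nx.
set F := (F in derivable F x 1 -> _).
have FE y : - N%:R < y < N%:R -> F y = G y - G (- N%:R).
  move=> /andP[Ny yN]; rewrite /F /Rintegral.
  under eq_integral do rewrite -[(f _)%:E]/((EFin \o f) _) fE.
  rewrite -hE; last exact: measurable_itv.
  rewrite /nu /= /mfrestr /mrestr (_ : _ `&` _ = `]- N%:R, y]%classic).
    by rewrite nuE ?ltW.
  apply/seteqP; split => z /=; rewrite /D /= !in_itv/=; first by case.
  by move=> /andP[-> zy]; split => //; rewrite (le_trans zy)// ltW.
move=> dF; have : derivable (fun y => F y + G (- N%:R)) x 1.
  by apply: (derivableD dF); exact: derivable_cst.
apply: near_eq_derivable.
near=> y; rewrite FE ?subrK//; apply/andP; split; near: y.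
  exact: lt_nbhsr. exact: lt_nbhsl.
Unshelve. all: by end_near. Qed.

End lipschitz_line.

Section lipschitz_facts.
Context {R : realType}.

Lemma lipschitzP (V W : normedModType R) (f : V -> W) :
  lipschitz f <-> exists2 K : R, 0 <= K & forall x y, `|f x - f y| <= K * `|x - y|.
Proof.
split=> [[M [Mr fM]]|[K K0 fK]].
  exists (`|M| + 1); first by rewrite addr_ge0.
  move=> x y; apply: (fM (`|M| + 1) _ (x, y)) => //.
  by rewrite (le_lt_trans (ler_norm _))// ltrDl.
apply: (@klipschitzW _ _ _ K); last by move=> -[x y] _ /=; exact: fK.
exact: (@globally_properfilter _ _ (0, 0)).
Qed.

Lemma lipschitz_lin (V : normedModType R) (f g : V -> R) (a b : R) :
  lipschitz f -> lipschitz g -> lipschitz (fun x => a * f x + b * g x).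
Proof.
move=> /lipschitzP[K K0 fK] /lipschitzP[L L0 gL]; apply/lipschitzP.
exists (`|a| * K + `|b| * L) => [|x y]; first by rewrite addr_ge0// mulr_ge0.
rewrite opprD addrACA -!mulrBr (le_trans (ler_normD _ _))// !normrM mulrDl -!mulrA.
by rewrite lerD// ler_wpM2l.
Qed.

Lemma lipschitz_norm (V : normedModType R) (f : V -> R) :
  lipschitz f -> lipschitz (fun x => `|f x|).
Proof.
move=> /lipschitzP[K K0 fK]; apply/lipschitzP; exists K => // x y.
exact: le_trans (ler_dist_dist _ _) (fK x y).
Qed.

Lemma lipschitz_continuous (V W : normedModType R) (f : V -> W) :
  lipschitz f -> continuous f.
Proof.
move=> /lipschitzP[K K0 fK] x; apply/cvgrPdist_lt => e e0; near=> y.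
rewrite (le_lt_trans (fK _ _))// (@le_lt_trans _ _ ((K + 1) * `|x - y|))//.
  by rewrite ler_wpM2r// lerDl.
rewrite -ltr_pdivlMl ?ltr_wpDl//.
by near: y; apply: cvgr_dist_lt => //; rewrite mulr_gt0// invr_gt0 ltr_wpDl.
Unshelve. all: by end_near. Qed.

(** Adding the line of slope [K] makes [f] nondecreasing, with increments at most [K + K] times
    those of the argument; the line is subtracted again at the end. *)
Lemma lipschitz_derivable_ae (f : R -> R) : lipschitz f ->
  (@lebesgue_measure R).-negligible [set t | ~ derivable f t 1].
Proof.
move=> lf; have [K K0 fK] := (lipschitzP f).1 lf.
pose G0 (t : R) := f t + K * t.
have G0nd : {homo G0 : x y / x <= y}.
  move=> x y xy; rewrite /G0 -lerBlDl addrAC -lerBrDr -mulrBr.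
  have := fK x y; rewrite ler_norml distrC (ger0_norm (_ : 0 <= y - x)) ?subr_ge0//.
  by move=> /andP[_]; lra.
have G0c : continuous G0.
  move=> t; apply: cvgD; first exact: lipschitz_continuous.
  by apply: cvgMr; exact: cvg_id.
pose G : cumulative R R := HB.pack G0
  (isCumulative.Build R _ R G0 G0nd (right_continuousW G0c)).
have : {ae (@lebesgue_measure R), forall x, derivable G x 1}.
  apply: (@nd_lipschitz_derivable _ G (K + K)) => x y xy; rewrite /= /G0.
  have := fK x y; rewrite ler_norml distrC (ger0_norm (_ : 0 <= y - x)) ?subr_ge0//.
  by move=> /andP[+ _]; lra.
apply: negligibleS => t /= ndf dG; apply: ndf.
rewrite (_ : f = G0 \- (fun t => K * t)); last first.
  by apply/funext => s; rewrite /G0/= addrK.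
apply: (derivableB dG); apply: derivableM; [exact: derivable_cst|exact: derivable_id].
Qed.

End lipschitz_facts.

(** * Measurable sets of R^n, and Fubini along lines parallel to an axis *)

Section borel_row_theory.
Context {R : realType} {n : nat}.

Lemma ler_norm_coor (x : 'rV[R]_n) i : `|x ord0 i| <= `|x|.
Proof.
rewrite [leRHS]/Num.norm /= mx_normrE; apply/bigmax_geP; right => /=.
by exists (ord0, i).
Qed.

Lemma row_norm_lt (x : 'rV[R]_n) (e : R) : 0 < e -> (forall i, `|x ord0 i| < e) -> `|x| < e.
Proof.
move=> e0 xe; rewrite [ltLHS]/Num.norm /= mx_normrE; apply/bigmax_ltP; split => //.
by move=> [i j] _ /=; rewrite ord1.
Qed.

Lemma row_norm_le (x : 'rV[R]_n) (e : R) : 0 <= e -> (forall i, `|x ord0 i| <= e) -> `|x| <= e.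
Proof.
move=> e0 xe; rewrite [leLHS]/Num.norm /= mx_normrE; apply/bigmax_leP; split => //.
by move=> [i j] _ /=; rewrite ord1.
Qed.

(** The sigma-algebra is generated by the coordinates, so openness has to be reduced to boxes: an
    open set is the union of the boxes with rational centre and half-side [1/(k+1)] that it
    contains, and there are countably many of them. *)
Lemma open_measurable_row (U : set 'rV[R]_n) : open U -> measurable U.
Proof.
move=> oU.
pose B (q : 'rV[rat]_n * nat) : set 'rV[R]_n :=
  [set x | forall i, ratr (q.1 ord0 i) - q.2.+1%:R^-1 < x ord0 i < ratr (q.1 ord0 i) + q.2.+1%:R^-1].
pose F k := if unpickle k is Some q then (if `[< B q `<=` U >] then B q else set0) else set0.
have mB q : measurable (B q).
  rewrite (_ : B q = \bigcap_(i in [set: 'I_n])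
    ((fun x : 'rV[R]_n => x ord0 i : measurableTypeR R) @^-1`
      `]ratr (q.1 ord0 i) - q.2.+1%:R^-1, ratr (q.1 ord0 i) + q.2.+1%:R^-1[)).
    apply: fin_bigcap_measurable => // i _; rewrite -[X in measurable X]setTI.
    by apply: measurable_coor => //; exact: measurable_itv.
  apply/seteqP; split => [x xq i _|x xq i] /=; first by rewrite in_itv/= xq.
  by have := xq i I; rewrite /= in_itv/=.
have -> : U = \bigcup_k F k.
  apply/seteqP; split => [x Ux|x [k _]]; last first.
    by rewrite /F; case: unpickle => // q; case: ifPn => // /asboolP; apply.
  have /nbhs_ballP[e /= e0 xeU] : nbhs x U by exact: open_nbhs_nbhs.
  have [k ke] : exists k : nat, k.+1%:R^-1 < e / 2.
    have [k ke] := ltr_add_invr (divr_gt0 e0 (ltr0n R 2)).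
    by exists k; move: ke; rewrite add0r.
  have /choice[q qx] : forall i, exists q : rat, x ord0 i - k.+1%:R^-1 < ratr q < x ord0 i + k.+1%:R^-1.
    move=> i; have [|q] := @rat_in_itvoo R (x ord0 i - k.+1%:R^-1) (x ord0 i + k.+1%:R^-1).
      by rewrite ltrBlDr -addrA ltrDl addr_gt0// invr_gt0.
    by rewrite in_itv/=; exists q.
  exists (pickle (\row_i q i, k)) => //; rewrite /F pickleK.
  have xB : B (\row_i q i, k) x.
    by move=> i; rewrite /= mxE; have /andP[] := qx i; move: (ratr _) (k.+1%:R^-1) => r c; lra.
  rewrite ifT//; apply/asboolP => y yB; apply: xeU.
  rewrite mx_norm_ball /ball_ /=; apply: row_norm_lt => // i.
  have /andP[] := xB i; have /andP[] := yB i; rewrite /= !mxE ltr_norml; move: ke.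
  by move: (ratr _) (k.+1%:R^-1) => r c ? ? ? ? ?; apply/andP; split; lra.
by apply: bigcup_measurable => k _; rewrite /F; case: unpickle => // q; case: ifPn.
Qed.

Lemma continuous_measurable_row (f : 'rV[R]_n -> R) : continuous f ->
  measurable_fun setT f.
Proof.
move=> /continuousP cf.
apply: (measurability _ (RGenOpens.measurableE R)).
move=> _ [_ [a [b ->] <-]]; rewrite setTI; apply: open_measurable_row.
exact/cf/interval_open.
Qed.

Lemma measurable_lebesgue (A : set 'rV[R]_n) :
  measurable A -> measurable (A : set (lebesgue_row R n)).
Proof.
move=> mA; apply: (@sub_caratheodory _ _ _ (borel_measure R n)).
by apply: sub_sigma_algebra.
Qed.

Lemma lebesgue_borel (A : set 'rV[R]_n) : measurable A ->
  @lebesgue R n A = borel_measure R n A.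
Proof. by move=> mA; apply: measurable_mu_extE. Qed.

Lemma lebesgue_complete : measure_is_complete (@lebesgue R n).
Proof. exact: measure_is_complete_caratheodory. Qed.

Lemma measurable_fun_lebesgue d (T : measurableType d) (f : 'rV[R]_n -> T) (D : set 'rV[R]_n) :
  measurable_fun D f -> measurable D -> measurable_fun (D : set (lebesgue_row R n)) f.
Proof. by move=> mf mD _ Y mY; apply: measurable_lebesgue; exact: mf. Qed.

End borel_row_theory.

Lemma eq_row (V : Type) n (u v : 'rV[V]_n) :
  (forall k, u ord0 k = v ord0 k) -> u = v.
Proof. by move=> uv; apply/rowP => k; rewrite (_ : 0 = ord0)//; exact: val_inj. Qed.

(** Fubini, by induction on the dimension. The iterated product splits off the first coordinate. If
    direction [i] is another one, each slice is null by induction; if it is the first, the order of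
    integration is exchanged by uniqueness of the product measure. *)
Lemma borel_measure_null (R : realType) n (i : 'I_n) (N : set 'rV[R]_n) :
  measurable N ->
  (forall x, (@lebesgue_measure R).-negligible
     [set t : R | N (x + t *: delta_mx ord0 i)]) ->
  borel_measure R n N = 0%E.
Proof.
elim: n i N => [[]//|n IH] i N mN Ni.
have mN' : measurable (@cons_row R n @^-1` N).
  by rewrite -[X in measurable X]setTI; apply: measurable_cons_row.
have -> : borel_measure R n.+1 N = (lebesgue_measure \x borel_measure R n)%E (@cons_row R n @^-1` N) by [].
have [j ji|i0] := unliftP ord0 i.
  rewrite /product_measure1 integral0_eq// => t _ /=.
  apply: (IH j); first exact: measurable_xsection.
  move=> x; apply: negligibleS (Ni (cons_row (t, x))) => s /=.
  rewrite /xsection /= inE /=; congr N; apply: eq_row => k.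
  rewrite ji; have [k' ->|->] := unliftP ord0 k.
    by rewrite cons_rowS [RHS]mxE cons_rowS !mxE (inj_eq (@lift_inj _ _)).
  by rewrite cons_row0 [RHS]mxE cons_row0 !mxE /= mulr0 addr0.
transitivity ((lebesgue_measure \x^ borel_measure R n)%E (@cons_row R n @^-1` N)).
  by apply: product_measure_unique => //= A B mA mB; rewrite product_measure2E.
rewrite /product_measure2 integral0_eq// => x _ /=.
apply/negligibleP; first exact: measurable_ysection.
apply: negligibleS (Ni (cons_row (0, x))) => s /=.
rewrite /ysection /= inE /=; congr N; apply: eq_row => k.
rewrite i0; have [k' ->|->] := unliftP ord0 k.
  by rewrite cons_rowS [RHS]mxE cons_rowS !mxE /= mulr0 addr0.
by rewrite cons_row0 [RHS]mxE cons_row0 !mxE /= mulr1 add0r.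
Qed.

(** * Partial derivatives of a Lipschitz function: existence almost everywhere and measurability *)

Section partial_derivative.
Context {R : realType} {n : nat}.
Variables (f : 'rV[R]_n -> R) (i : 'I_n).
Hypothesis lf : lipschitz f.

Let e : 'rV[R]_n := delta_mx ord0 i.
Let q (h : R) (x : 'rV[R]_n) : R := h^-1 *: (f (h *: e + x) - f x).

Let q_lipschitz h : lipschitz (q h).
Proof.
rewrite (_ : q h = fun x => h^-1 * f (h *: e + x) + (- h^-1) * f x); last first.
  by apply/funext => x; rewrite /q scalerBr mulNr.
apply: lipschitz_lin => //; have [K K0 fK] := (lipschitzP f).1 lf.
apply/lipschitzP; exists K => // y z; rewrite (le_trans (fK _ _))//.
by rewrite opprD addrACA subrr add0r.
Qed.

(** The Cauchy criterion for the difference quotients, with tolerance [1/(k+1)] for all nonzero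
    steps below [1/(m+1)]. The intersection is uncountable, but its members are closed, so it is
    closed and hence measurable. *)
Let dq (k m : nat) : set 'rV[R]_n := \bigcap_(h in [set h : R * R |
    [/\ h.1 != 0, h.2 != 0, `|h.1| < m.+1%:R^-1 & `|h.2| < m.+1%:R^-1]])
  [set x | `|q h.1 x - q h.2 x| <= k.+1%:R^-1].

Let dq_measurable k m : measurable (dq k m).
Proof.
suff cl : closed (dq k m).
  rewrite -[X in measurable X]setCK; apply: measurableC.
  by apply: open_measurable_row; exact: closed_openC.
apply: closed_bigI => h _.
apply: (@closed_comp _ _ (fun x => `|q h.1 x - q h.2 x|) [set r | r <= k.+1%:R^-1]).
  move=> x _; apply: lipschitz_continuous; apply: lipschitz_norm.
  rewrite (_ : (fun _ => _) = fun x => 1 * q h.1 x + (-1) * q h.2 x).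
    exact: lipschitz_lin.
  by apply/funext => y; rewrite mul1r mulN1r.
exact: closed_le.
Qed.

Let derivable_dq : [set x | derivable f x e] = \bigcap_k \bigcup_m dq k m.
Proof.
have qE x : (fun h : R => h^-1 *: ((f \o shift x) (h *: e) - f x)) = q ^~ x by [].
apply/seteqP; split => [x|x xdq]; rewrite /= /derivable qE.
  move=> /cvg_ex[l ql] k _.
  have [m _ mh] : exists2 m : nat, True & forall h : R, h != 0 -> `|h| < m.+1%:R^-1 ->
      `|l - q h x| < k.+1%:R^-1 / 2.
    have k0 : 0 < k.+1%:R^-1 / 2 :> R by rewrite divr_gt0.
    move/cvgrPdist_lt : ql => /(_ _ k0) [d /= d0 dq'].
    have [m md] := ltr_add_invr d0.
    exists m => // h h0 hm; apply: dq' => //=; rewrite sub0r normrN (lt_trans hm)//.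
    by move: md; rewrite add0r.
  exists m => // h [h10 h20 h1 h2] /=.
  have := mh _ h10 h1; have := mh _ h20 h2.
  move: (k.+1%:R^-1) => c; rewrite !ltr_norml => /andP[? ?] /andP[? ?].
  by rewrite ler_norml; apply/andP; split; lra.
apply/cauchy_cvgP; apply: cauchy_exP => d /= d0.
have [k kd] := ltr_add_invr d0; rewrite add0r in kd.
have [m _ mx] := xdq k I.
have m0 : 0 < m.+1%:R^-1 / 2 :> R by rewrite divr_gt0.
exists (q (m.+1%:R^-1 / 2) x).
exists (m.+1%:R^-1) => /=; first by rewrite invr_gt0.
move=> h /=; rewrite sub0r normrN => hm h0; rewrite /ball /=.
rewrite (le_lt_trans _ kd)//; apply: (mx (_, _)); split => //=.
  by rewrite gt_eqF.
by rewrite gtr0_norm// ltr_pdivrMr// ltr_pMr ?invr_gt0// ltr1n.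
Qed.

Lemma measurable_derivable : measurable [set x | derivable f x e].
Proof.
rewrite derivable_dq; apply: bigcapT_measurable => k.
by apply: bigcup_measurable => m _; exact: dq_measurable.
Qed.

(* Fubini reduces Rademacher's theorem in direction [e] to the lines parallel to [e]. *)
Lemma derivable_coor_ae :
  {ae @lebesgue R n, forall x, derivable f x e}.
Proof.
pose N := ~` [set x | derivable f x e].
have mN : measurable N by apply: measurableC; exact: measurable_derivable.
exists N; split => //; first exact: measurable_lebesgue.
rewrite lebesgue_borel//; apply: (@borel_measure_null _ _ i) => // x.
pose g (t : R) := f (x + t *: e).
have lg : lipschitz g.
  have [K K0 fK] := (lipschitzP f).1 lf.
  apply/lipschitzP; exists (K * `|e|); first by rewrite mulr_ge0.
  move=> s t; rewrite (le_trans (fK _ _))// opprD addrACA subrr add0r -scalerBl.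
  by rewrite normrZ -mulrA [`|e| * _]mulrC.
apply: negligibleS (lipschitz_derivable_ae lg) => t /=; apply: contra_not.
rewrite /derivable /= -/e.
suff -> : (fun h : R => h^-1 *: ((g \o shift t) (h *: 1) - g t)) =
  (fun h : R => h^-1 *: ((f \o shift (x + t *: e)) (h *: e) - f (x + t *: e))) by [].
apply/funext => h.
by rewrite /g /= scalerDl addrCA [h *: 1]mulr1.
Qed.

(** Where [f] is derivable the partial derivative is the limit of the quotients with step [1/(k+1)].
    Elsewhere the value of ['D_e f] is arbitrary, but that set is null and Lebesgue measure is
    complete. *)
Lemma measurable_partial :
  measurable_fun [set: lebesgue_row R n] (fun x => 'D_e f x : R).
Proof.
pose N := ~` [set x | derivable f x e].
have mN : measurable N by apply: measurableC; exact: measurable_derivable.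
have mNL := measurable_lebesgue mN.
have mq h : measurable_fun [set: lebesgue_row R n] (q h).
  apply: measurable_fun_lebesgue => //; apply: continuous_measurable_row.
  exact/lipschitz_continuous/q_lipschitz.
rewrite -(setvU N); apply/(measurable_funU _ (measurableC mNL) mNL).
split.
  apply: (@measurable_fun_cvg _ (lebesgue_row R n) R (~` N) (fun k => q k.+1%:R^-1)).
    by move=> k; exact: measurable_funTS.
  move=> x /= /contrapT dfx.
  have /cvg_dnbhs_at_right/cvg_at_rightP : q ^~ x @ 0^' --> ('D_e f x : R) by exact: dfx.
  by apply; split; [move=> k; rewrite invr_gt0|exact: cvg_harmonic].
move=> _ Y mY; apply: lebesgue_complete; exists N; split => //.
by have [A [mA A0 NA]] := derivable_coor_ae; rewrite (subset_measure0 _ _ NA).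
Qed.

End partial_derivative.

(** * Square roots of positive semi-definite matrices *)

Section psd_sqrt.
Context {R : realType}.
Implicit Types n : nat.

Lemma innerE n (x y : 'rV[R]_n) : inner x y = (x *m y^T) 0 0.
Proof. by rewrite mxE; apply: eq_bigr => i _; rewrite mxE. Qed.

Lemma inner_mulmx n (A : 'M[R]_n) (x y : 'rV[R]_n) :
  A^T = A -> inner (x *m A) y = inner x (y *m A).
Proof. by move=> sA; rewrite !innerE trmx_mul sA mulmxA. Qed.

Lemma inner_ge0 n (x : 'rV[R]_n) : 0 <= inner x x.
Proof. by apply: sumr_ge0 => i _; rewrite -expr2 sqr_ge0. Qed.

Lemma inner_eq0 n (x : 'rV[R]_n) : inner x x = 0 -> x = 0.
Proof.
move/psumr_eq0P => x0; apply/rowP => i; rewrite mxE.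
have /eqP := x0 (fun i _ => sqr_ge0 (x ord0 i)) i isT.
by rewrite mulf_eq0 orbb => /eqP <-; congr (x _ _); exact: val_inj.
Qed.

Lemma psd_eigenvalue_ge0 n (A : 'M[R]_n) (a : R) : psd A -> eigenvalue A a -> 0 <= a.
Proof.
move=> [_ A0] /eigenvalueP[v vA v0].
have := A0 v; rewrite vA innerE -scalemxAl mxE -innerE pmulr_lge0//.
by rewrite lt_neqAle inner_ge0 andbT eq_sym; apply: contra v0 => /eqP/inner_eq0/eqP.
Qed.

Lemma interpolation (s : R -> R) (xs : seq R) :
  exists h : {poly R}, forall x, x \in xs -> h.[x] = s x.
Proof.
elim: xs => [|a xs [h hE]]; first by exists 0.
have [axs|axs] := boolP (a \in xs).
  by exists h => x; rewrite inE => /predU1P[->|]; exact: hE.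
pose w := \prod_(x <- xs) ('X - x%:P).
have wa : w.[a] != 0 by rewrite -rootE root_prod_XsubC.
exists (h + ((s a - h.[a]) / w.[a]) *: w) => x; rewrite inE hornerD hornerZ.
case/predU1P => [->|xxs]; first by rewrite divfK// addrC subrK.
have /rootP -> : root w x by rewrite root_prod_XsubC.
by rewrite mulr0 addr0 hE.
Qed.

Lemma trmx_horner n (A : 'M[R]_n.+1) (h : {poly R}) : A^T = A ->
  (horner_mx A h)^T = horner_mx A h.
Proof.
move=> sA; elim/poly_ind: h => [|h c IH]; first by rewrite rmorph0 trmx0.
rewrite rmorphD rmorphM /= horner_mx_X horner_mx_C linearD /= trmx_mul IH sA.
by rewrite tr_scalar_mx; congr (_ + _); apply: comm_mx_horner.
Qed.

(* Interpolating the fourth roots of the eigenvalues gives a symmetric H with H^4 = A; *)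
(* then H^2 is visibly positive semi-definite. *)
Lemma psd_sqrt_exists n (A : 'M[R]_n) : psd A ->
  exists B : 'M[R]_n, psd B /\ B *m B = A.
Proof.
case: n A => [|n] A pA.
  exists A; split => //; by rewrite [LHS]flatmx0 [RHS]flatmx0.
(* [A] is diagonalized as a complex Hermitian matrix. Its eigenvalues are real, and a polynomial in
   [A] with real coefficients leads back to real matrices. *)
pose f := real_complex R; pose AC := map_mx f A.
have hA : AC \is hermsymmx.
  apply: realsym_hermsym.
    apply/is_hermitianmxP; rewrite expr0 scale1r map_mx_id//.
    by apply/matrixP => i j; rewrite !mxE -[in LHS]pA.1 mxE.
  by apply/mxOverP => i j; rewrite mxE; apply/complex_realP; exists (A i j).
have /orthomx_spectralP := hermitian_normalmx hA.
have := hermitian_spectral_diag_real hA.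
have := spectral_unit AC.
set P := spectralmx AC; set D := spectral_diag AC => Pu Dr AE.
have /choice[r rE] : forall j, exists x, D 0 j = f x.
  by move=> j; have /mxOverP/(_ 0 j)/complex_realP := Dr.
have r0 j : 0 <= r j.
  apply: psd_eigenvalue_ge0 pA _; rewrite eigenvalue_root_char -(fmorph_root f).
  rewrite map_char_poly [X in root _ X](_ : _ = D 0 j) ?rE// -eigenvalue_root_char; apply/eigenvalueP.
  exists (row j P); last first.
    apply: contraTneq Pu => Pj0; rewrite unitmxE (expand_det_row _ j) big1 ?unitr0// => k _.
    by move/rowP: Pj0 => /(_ k); rewrite !mxE => ->; rewrite mul0r.
  have PA : P *m AC = diag_mx D *m P by rewrite [in LHS]AE !mulmxA mulmxV// mul1mx.
  by rewrite -row_mul PA; apply/rowP => k; rewrite mul_diag_mx !mxE rE.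
have [h hE] := interpolation (fun x => Num.sqrt (Num.sqrt x)) (codom r).
have hr j : (h ^+ 4).[r j] = r j.
  rewrite horner_exp hE ?codom_f// (_ : 4 = 2 * 2)%N// exprM.
  by rewrite !sqr_sqrtr// sqrtr_ge0.
pose H := horner_mx A h.
have sH : H^T = H by exact: trmx_horner pA.1.
(* The polynomial [h ^+ 4 - 'X] vanishes at every eigenvalue, so it annihilates the diagonal form
   and therefore [A]. *)
have H4 : H *m H *m (H *m H) = A.
  have : horner_mx A (h ^+ 4 - 'X) = 0.
    apply: (map_mx_inj (f := f)); rewrite map_mx0 map_horner_mx.
    rewrite -/AC AE -[X in _ *m X]invmxK horner_mx_uconj ?unitmx_inv//.
    rewrite horner_mx_diag (_ : map_mx _ D = 0).
      by rewrite (_ : diag_mx 0 = 0) ?mulmx0 ?mul0mx//; apply/matrixP => i j; rewrite !mxE mul0rn.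
    apply/rowP => j; rewrite !mxE rE horner_map.
    by rewrite hornerD hornerN hornerX hr subrr rmorph0.
  rewrite rmorphB rmorphXn /= horner_mx_X => /subr0_eq <-.
  by rewrite -/H !exprS expr0 mulr1 -!mulmxE !mulmxA.
exists (H *m H); split => //; split; first by rewrite trmx_mul sH.
by move=> x; rewrite mulmxA inner_mulmx// inner_ge0.
Qed.

(** Whichever root [B] is selected by [xget], symmetry and [B *m B = A] give |xB|^2 = <xA, x>. From
    here on the square root is replaced by the quadratic form of [A]. *)
Lemma enorm_sqrt_mx n (A : 'M[R]_n) (x : 'rV[R]_n) : psd A ->
  enorm (x *m sqrt_mx A) = Num.sqrt (inner (x *m A) x).
Proof.
move=> /psd_sqrt_exists[B0 B0P]; rewrite /enorm /sqrt_mx.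
case: xgetP => [B _ [pB BE]|/(_ B0)//]; rewrite inner_mulmx; last exact: pB.1.
by rewrite -mulmxA BE -inner_mulmx// -BE trmx_mul pB.1.
Qed.

End psd_sqrt.

(** * Inequalities for real powers *)

Section powR_inequalities.
Context {R : realType}.
Implicit Types p x y s t r d m u eps eta : R.

Lemma ler_powR_nneg p x y : 0 <= p -> 0 <= x -> x <= y -> x `^ p <= y `^ p.
Proof.
by move=> p0 x0 xy; rewrite ge0_ler_powR// nnegrE// (le_trans x0).
Qed.

Lemma ler_sqr_nneg x y : 0 <= x -> x <= y -> x ^+ 2 <= y ^+ 2.
Proof. by move=> x0 xy; rewrite !expr2 ler_pM. Qed.

Lemma powR1E p : 1 `^ p = 1 :> R.
Proof. by rewrite powR1. Qed.

(** Young's inequality for the product of [x] and 1, with exponents p and p/(p-1). *)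
Lemma powR_bernoulli p x : 1 < p -> 0 <= x -> 1 + p * (x - 1) <= x `^ p.
Proof.
move=> p1 x0; have p0 : 0 < p by rewrite (lt_trans ltr01).
have q0 : 0 < p - 1 by rewrite subr_gt0.
have := @conjugate_powR _ x 1 p (p / (p - 1)) x0 ler01 p0 (divr_gt0 p0 q0).
rewrite mulr1 powR1 invf_div.
have -> : p^-1 + (p - 1) / p = 1 by rewrite -{1}(mul1r p^-1) -mulrDl addrC subrK divff// gt_eqF.
move=> /(_ erefl); rewrite mul1r -mulrDl ler_pdivlMr//; nra.
Qed.

Lemma powR_tangent p m x : 1 < p -> 0 < m -> 0 <= x ->
  m `^ p * (1 + p * (x / m - 1)) <= x `^ p.
Proof.
move=> p1 m0 x0; have xm0 : 0 <= x / m by rewrite divr_ge0// ltW.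
rewrite -[in leRHS](divfK (lt0r_neq0 m0) x) (powRM _ xm0 (ltW m0)) [leLHS]mulrC.
by rewrite ler_wpM2r ?powR_ge0// powR_bernoulli.
Qed.

(** Average the two tangent inequalities at the mean [m]: the linear terms cancel. *)
Lemma powR_convex p u x y : 1 < p -> 0 <= u <= 1 -> 0 <= x -> 0 <= y ->
  ((1 - u) * x + u * y) `^ p <= (1 - u) * x `^ p + u * y `^ p.
Proof.
move=> p1 /andP[u0 u1] x0 y0; set m := (X in X `^ p).
have m0 : 0 <= m by rewrite addr_ge0// mulr_ge0// subr_ge0.
have [->|mn0] := eqVneq m 0.
  rewrite powR0; last by rewrite gt_eqF// (lt_trans ltr01).
  by rewrite addr_ge0// mulr_ge0// ?powR_ge0 ?subr_ge0.
have mp : 0 < m by rewrite lt_neqAle eq_sym mn0.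
rewrite (@le_trans _ _ ((1 - u) * (m `^ p * (1 + p * (x / m - 1))) + u * (m `^ p * (1 + p * (y / m - 1)))))//.
  have -> : (1 - u) * (m `^ p * (1 + p * (x / m - 1))) + u * (m `^ p * (1 + p * (y / m - 1))) =
    m `^ p * (1 + p * (((1 - u) * x + u * y) / m - 1)) by ring.
  by rewrite -/m divff// subrr mulr0 addr0 mulr1.
by rewrite lerD// ler_wpM2l ?subr_ge0// powR_tangent.
Qed.

(* Applying Bernoulli's inequality to the square root of [x] makes it strict. *)
Lemma powR_bernoulli_strict p x : 1 < p -> 1 <= x ->
  1 + p * (x - 1) + (p ^+ 2 - p) * (Num.sqrt x - 1) ^+ 2 <= x `^ p.
Proof.
move=> p1 x1; set z := Num.sqrt x.
have x0 : 0 <= x by rewrite (le_trans ler01).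
have z1 : 1 <= z by rewrite -sqrtr1 ler_wsqrtr.
have z0 : 0 <= z by rewrite (le_trans ler01).
have xz : x = z * z by rewrite -expr2 sqr_sqrtr.
rewrite [in leRHS]xz powRM// xz.
have b := powR_bernoulli p1 z0.
have b0 : 0 <= 1 + p * (z - 1) by rewrite addr_ge0// mulr_ge0 ?subr_ge0// ltW// (lt_trans ltr01).
apply: le_trans (ler_pM b0 b0 b b); nra.
Qed.

(** Let [m] be the mean and [s] the larger number, so that [s / m >= 1 + y]. Add the strict
    Bernoulli inequality at [s / m] to the tangent inequality at [t]: the linear terms cancel as
    [s / m + t / m = 2], and the surplus with [e = sqrt(1 + y) - 1] remains. *)
Lemma powR_midpoint_strict p y : 1 < p -> 0 < y -> exists2 c : R, 0 < c &
  forall s t, 0 <= s -> 0 <= t -> y * (s + t) <= `|s - t| ->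
  (1 + c) * ((s + t) / 2) `^ p <= (s `^ p + t `^ p) / 2.
Proof.
move=> p1 y0; have p0 : 0 < p by rewrite (lt_trans ltr01).
pose e := Num.sqrt (1 + y) - 1.
have e0 : 0 < e by rewrite subr_gt0 -{1}sqrtr1 ltr_sqrt ?ltrDl// addr_gt0.
exists ((p ^+ 2 - p) * e ^+ 2 / 2).
  by rewrite divr_gt0// mulr_gt0 ?exprn_gt0//; nra.
move=> s t s0 t0; wlog st : s t s0 t0 / t <= s.
  move=> H yst; have [/(H s t s0 t0)|/ltW] := leP t s; first exact.
  by move=> /(H _ _ t0 s0); rewrite distrC [t + s]addrC [t `^ _ + _]addrC; apply.
rewrite ger0_norm ?subr_ge0// => yst.
set m := (s + t) / 2; have m0 : 0 <= m by rewrite divr_ge0// addr_ge0.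
have [m00|mn0] := eqVneq m 0.
  by rewrite m00 powR0 ?gt_eqF// mulr0 divr_ge0// addr_ge0// powR_ge0.
have mp : 0 < m by rewrite lt_neqAle eq_sym mn0.
have sm1 : 1 + y <= s / m by rewrite ler_pdivlMr// /m; lra.
have sE : s `^ p = m `^ p * (s / m) `^ p.
  by rewrite mulrC -powRM ?divfK// divr_ge0.
have sm := @powR_bernoulli_strict p (s / m) p1 (le_trans _ sm1).
rewrite lerDl (ltW y0) in sm; have {}sm := sm isT.
have ess : e ^+ 2 <= (Num.sqrt (s / m) - 1) ^+ 2.
  by rewrite ler_sqr ?nnegrE ?(ltW e0)// ?subr_ge0 ?lerB// ?ler_wsqrtr//
    -?[X in X <= _]sqrtr1 ?ler_wsqrtr// (le_trans _ sm1)// lerDl ltW.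
have tm := powR_tangent p1 mp t0.
have pp : 0 < p ^+ 2 - p by nra.
have : m `^ p * (1 + p * (s / m - 1) + (p ^+ 2 - p) * e ^+ 2) <= s `^ p.
  rewrite sE ler_wpM2l ?powR_ge0// (le_trans _ sm)// lerD2l.
  by rewrite ler_pM2l.
move: tm; have -> : t / m = 2 - s / m.
  by apply: (mulIf mn0); rewrite mulrBl !divfK// /m; lra.
move: (m `^ p) (s / m) => M S; lra.
Qed.

(** Here [s], [t] are the norms of two vectors, [r] that of their midpoint and [d] that of their
    difference; the quadratic hypothesis is the parallelogram law. With [m] the mean of [s] and [t]:
    if [d <= e * m] the [eps] term suffices. Otherwise the defect is at least [dl * m ^ p], while
    [d <= 2 * m]: either the midpoint is short, [r <= rho * m], or [s] and [t] are far apart and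
    [powR_midpoint_strict] applies. *)
Lemma powR_uniform_convexity p eps : 1 < p -> 0 < eps ->
  exists2 K : R, 0 <= K & forall s t r d, 0 <= s -> 0 <= t -> 0 <= r -> 0 <= d ->
  r ^+ 2 + d ^+ 2 / 4 = (s ^+ 2 + t ^+ 2) / 2 -> r <= (s + t) / 2 -> d <= s + t ->
  0 <= (s `^ p + t `^ p) / 2 - r `^ p /\
  d `^ p <= eps * (s `^ p + t `^ p) + K * ((s `^ p + t `^ p) / 2 - r `^ p).
Proof.
move=> p1 eps0; have p0 : 0 < p by rewrite (lt_trans ltr01).
pose e := Num.min 1 (eps `^ p^-1).
have e0 : 0 < e by rewrite lt_min ltr01 powR_gt0.
have e1 : e <= 1 by rewrite ge_min lexx.
have eeps : e `^ p <= eps.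
  rewrite (@le_trans _ _ ((eps `^ p^-1) `^ p))//.
    by rewrite ler_powR_nneg ?(ltW p0) ?(ltW e0)// ge_min lexx orbT.
  by rewrite -powRrM mulVf ?gt_eqF// powRr1 ?(ltW eps0).
(* With this [rho], the parallelogram law turns [r > rho * m] and [d > e * m] into
   [|s - t| >= e * m / 2], that is [e / 4] times [s + t]. *)
pose rho := Num.sqrt (1 - e ^+ 2 / 8).
have rho2 : rho ^+ 2 = 1 - e ^+ 2 / 8 by rewrite sqr_sqrtr//; nra.
have rho0 : 0 <= rho by exact: sqrtr_ge0.
have rho1 : rho < 1 by rewrite -(@sqrtr1 R) ltr_sqrt// ltrBlDr ltrDl divr_gt0// exprn_gt0.
have [c c0 cP] := powR_midpoint_strict p1 (divr_gt0 e0 (ltr0n R 4)).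
pose dl := Num.min c (1 - rho `^ p).
have dl0 : 0 < dl.
  rewrite lt_min c0 subr_gt0 -(powR1E p) gt0_ltr_powR// nnegrE ?ler01 ?sqrtr_ge0//.
exists (2 `^ p / dl); first by rewrite divr_ge0// ?powR_ge0// ltW.
move=> s t r d s0 t0 r0 d0 pl rst dst.
set m := (s + t) / 2 in rst *; have m0 : 0 <= m by rewrite divr_ge0// addr_ge0.
have mid : m `^ p <= (s `^ p + t `^ p) / 2.
  have := @powR_convex p (2^-1) s t p1 _ s0 t0.
  have -> : (1 - 2^-1) * s + 2^-1 * t = m by rewrite /m; lra.
  have -> : (1 - 2^-1) * s `^ p + 2^-1 * t `^ p = (s `^ p + t `^ p) / 2 by lra.
  by apply; apply/andP; split; lra.
have rm : r `^ p <= m `^ p by rewrite ler_powR_nneg// ltW.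
have D0 : 0 <= (s `^ p + t `^ p) / 2 - r `^ p by rewrite subr_ge0 (le_trans rm).
split=> //; have stp : 0 <= s `^ p + t `^ p by rewrite addr_ge0// powR_ge0.
have [de|de] := leP d (e * m).
  rewrite -[leLHS]addr0 lerD//; last by rewrite mulr_ge0// divr_ge0// ?powR_ge0// ltW.
  rewrite (@le_trans _ _ ((e * m) `^ p))// ?ler_powR_nneg// ?(ltW p0)//.
  rewrite powRM ?(ltW e0)// ler_pM ?powR_ge0// (le_trans mid)//.
  by rewrite ler_pdivrMr// ler_peMr// ler1n.
rewrite -[leLHS]add0r lerD// ?mulr_ge0// ?(ltW eps0)//.
suff : dl * m `^ p <= (s `^ p + t `^ p) / 2 - r `^ p.
  move=> H; rewrite (@le_trans _ _ ((2 * m) `^ p))//.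
    by rewrite ler_powR_nneg// ?(ltW p0)// /m mulrC divfK.
  rewrite powRM// -mulrA ler_wpM2l ?powR_ge0// mulrC ler_pdivlMr// mulrC.
  exact: H.
have mp0 : 0 <= m `^ p by rewrite powR_ge0.
have [rr|rr] := leP r (rho * m).
  have : r `^ p <= rho `^ p * m `^ p.
    rewrite -powRM ?sqrtr_ge0// ler_powR_nneg// ?(ltW p0)//.
  have : dl * m `^ p <= (1 - rho `^ p) * m `^ p by rewrite ler_wpM2r// ge_min lexx orbT.
  lra.
have : (1 + c) * m `^ p <= (s `^ p + t `^ p) / 2.
  apply: cP => //.
  rewrite -ler_sqr ?nnegrE// ?mulr_ge0 ?addr_ge0 ?divr_ge0 ?(ltW e0)//.
  rewrite real_normK ?num_real//.
  have r2 : (rho * m) ^+ 2 <= r ^+ 2 by apply: ler_sqr_nneg; [exact: mulr_ge0|exact: ltW].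
  have d2 : (e * m) ^+ 2 <= d ^+ 2.
    by apply: ler_sqr_nneg; [exact: mulr_ge0 (ltW e0) _|exact: ltW].
  rewrite exprMn rho2 in r2; rewrite exprMn in d2.
  have stE : (s - t) ^+ 2 = 4 * ((s ^+ 2 + t ^+ 2) / 2) - 4 * m ^+ 2.
    by rewrite /m; field.
  have -> : e / 4 * (s + t) = e * m / 2 by rewrite /m; field.
  have -> : (e * m / 2) ^+ 2 = e ^+ 2 * m ^+ 2 / 4 by field.
  rewrite stE -pl; clearbody m; move: r2 d2; rewrite mulrBl mul1r mulrAC.
  have : 0 <= e ^+ 2 * m ^+ 2 by rewrite mulr_ge0// sqr_ge0.
  by move: (e ^+ 2 * m ^+ 2) (m ^+ 2) (r ^+ 2) (d ^+ 2) => a b f g; lra.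
have : dl * m `^ p <= c * m `^ p by rewrite ler_wpM2r// ge_min lexx.
lra.
Qed.

(** Choose [th] with [(1 + th) ^ p = 1 + eta]. If [y <= th * x] the first term is enough, and
    otherwise [x] is below [y / th] and the second one is. *)
Lemma powRD_le p eta : 0 < p -> 0 < eta -> exists2 K : R, 0 <= K &
  forall x y, 0 <= x -> 0 <= y ->
  (x + y) `^ p <= (1 + eta) * x `^ p + K * y `^ p.
Proof.
move=> p0 eta0; pose th := (1 + eta) `^ p^-1 - 1.
have th0 : 0 < th.
  rewrite subr_gt0 -[X in X < _](powR1E p^-1) gt0_ltr_powR ?invr_gt0 ?nnegrE ?ltrDl//.
  by rewrite addr_ge0// ltW.
have thp : (1 + th) `^ p = 1 + eta.
  by rewrite /th addrC subrK -powRrM mulVf ?gt_eqF// powRr1// addr_ge0// ltW.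
exists ((1 + th^-1) `^ p) => [|x y x0 y0]; first exact: powR_ge0.
have [yx|yx] := leP y (th * x).
  rewrite -[leLHS]addr0 lerD ?mulr_ge0 ?powR_ge0//.
  have th1 : 0 <= 1 + th by rewrite addr_ge0// ltW.
  rewrite -thp -(powRM _ th1 x0) ler_powR_nneg ?(ltW p0) ?addr_ge0//.
  by rewrite mulrDl mul1r lerD2l.
rewrite -[leLHS]add0r lerD ?mulr_ge0 ?powR_ge0 ?addr_ge0 ?(ltW eta0)//.
have th1 : 0 <= 1 + th^-1 by rewrite addr_ge0// invr_ge0 ltW.
rewrite -(powRM _ th1 y0) ler_powR_nneg ?(ltW p0) ?addr_ge0//.
by rewrite mulrDl mul1r addrC lerD2l mulrC ler_pdivlMr// mulrC ltW.
Qed.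

(** Young's inequality after scaling [x] by [c] and [y] by [1 / c], where [c ^ p = eta * p] makes
    the first coefficient equal to [eta]. *)
Lemma young_powR p eta : 1 < p -> 0 < eta -> exists2 K : R, 0 <= K &
  forall x y, 0 <= x -> 0 <= y ->
  x * y <= eta * x `^ p + K * y `^ (p / (p - 1)).
Proof.
move=> p1 eta0; have p0 : 0 < p by rewrite (lt_trans ltr01).
have q0 : 0 < p - 1 by rewrite subr_gt0.
pose c := (eta * p) `^ p^-1.
have c0 : 0 < c by rewrite powR_gt0// mulr_gt0.
have cp : c `^ p = eta * p.
  by rewrite /c -powRrM mulVf ?gt_eqF// powRr1// ltW// mulr_gt0.
exists (c^-1 `^ (p / (p - 1)) / (p / (p - 1))) => [|x y x0 y0].
  by rewrite divr_ge0 ?powR_ge0// divr_ge0// ltW.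
have -> : x * y = (c * x) * (c^-1 * y) by rewrite mulrACA divff ?gt_eqF// mul1r.
apply: le_trans (@conjugate_powR _ _ _ p (p / (p - 1)) _ _ p0 _ _) _.
- by rewrite mulr_ge0// ltW.
- by rewrite mulr_ge0// invr_ge0 ltW.
- exact: divr_gt0.
- by rewrite invf_div -{1}(mul1r p^-1) -mulrDl addrC subrK divff// gt_eqF.
rewrite !powRM ?invr_ge0 ?(ltW c0)// cp lerD//.
  by rewrite mulrAC mulfK ?gt_eqF.
by rewrite mulrAC.
Qed.

(** The one-sided derivative at t = 0 of |a + t b|^p, with [al], [be], [ga] standing for <a,a>,
    <a,b>, <b,b>. The power [p / 2] may fail to be derivable at 0, so [al = 0] is treated apart:
    then [be = 0] and the quotient is t^(p-1) [ga] ^ (p/2), which tends to 0. *)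
Lemma powR_quadratic_derivative p (al be ga : R) : 1 < p ->
  0 <= al -> 0 <= ga -> be ^+ 2 <= al * ga ->
  (fun k : nat => ((al + 2 * k.+1%:R^-1 * be + k.+1%:R^-1 ^+ 2 * ga) `^ (p / 2)
     - al `^ (p / 2)) / k.+1%:R^-1) @ \oo -->
  p * (al `^ ((p - 2) / 2) * be).
Proof.
move=> p1; have p0 : 0 < p by rewrite (lt_trans ltr01).
rewrite le_eqVlt => /predU1P[<-|al0] ga0 beg.
  have be0 : be = 0.
    by apply/eqP; rewrite -sqrf_eq0 eq_le sqr_ge0 andbT (le_trans beg)// mul0r.
  rewrite be0 !mulr0 powR0; last by rewrite gt_eqF// divr_gt0.
  rewrite (_ : (fun k => _) = fun k : nat => harmonic k `^ (p - 1) * ga `^ (p / 2)).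
    rewrite -[X in _ --> X](mul0r (ga `^ (p / 2))); apply: cvgMr_tmp.
    have /cvg_at_rightP := @powR_cvg0 R (p - 1) ltac:(by rewrite subr_gt0).
    by apply; split; [move=> k; rewrite invr_gt0|exact: cvg_harmonic].
  apply/funext => k; rewrite mulr0 !add0r subr0 /harmonic /=.
  set u := k.+1%:R^-1; have u0 : 0 < u by rewrite invr_gt0.
  rewrite powRM ?exprn_ge0 ?(ltW u0)//.
  rewrite mulrAC; congr (_ * _); rewrite -powR_mulrn ?(ltW u0)// -powRrM mulrC.
  rewrite powRB ?powRr1 ?(ltW u0) ?gt_eqF ?implybT// mulrC.
  by rewrite mulrCA divff ?mulr1.
have dq : is_derive (0 : R) 1 (fun u : R => al + 2 * u * be + u ^+ 2 * ga) (2 * be).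
  apply: is_derive_eq; rewrite !scaler0 /GRing.scale /=; ring.
have q0 : 0 < (fun u : R => al + 2 * u * be + u ^+ 2 * ga) 0.
  by rewrite /= !(mulr0, mul0r, expr0n, addr0).
have := @is_derive1_comp R (fun x => x `^ (p / 2)) _ 0 _ _ (is_derive1_powR (p / 2) q0) dq.
rewrite /= !(mulr0, mul0r, expr0n, addr0) => -[dd dE].
have -> : p * (al `^ ((p - 2) / 2) * be) = p / 2 * al `^ (p / 2 - 1) * (2 * be).
  by rewrite (_ : (p - 2) / 2 = p / 2 - 1) ; [field|field].
rewrite -dE.
have /cvg_dnbhs_at_right/cvg_at_rightP := dd.
move=> /(_ (fun k : nat => k.+1%:R^-1)) H.
have hp (k : nat) : 0 < k.+1%:R^-1 :> R by rewrite invr_gt0.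
move: (H (conj hp (@cvg_harmonic R))).
apply: cvg_trans; apply: near_eq_cvg; apply: nearW => k /=.
rewrite addr0 [_ *: 1]mulr1 [LHS]mulrC.
by rewrite !(mulr0, mul0r, expr0n, addr0).
Qed.

End powR_inequalities.

(** * Quadratic seminorms and completeness *)

Section qnorm.
Context {R : realType} {m : nat}.
Implicit Types (A : 'M[R]_m) (x y z b : 'rV[R]_m).

Definition bil A x y : R := inner (x *m A) y.

Definition qnorm A x : R := Num.sqrt (bil A x x).

Lemma bilDl A x y z : bil A (x + y) z = bil A x z + bil A y z.
Proof. by rewrite /bil !innerE !mulmxDl mxE. Qed.

Lemma bilDr A x y z : bil A x (y + z) = bil A x y + bil A x z.
Proof. by rewrite /bil !innerE linearD mulmxDr mxE. Qed.

Lemma bilZl A (a : R) x y : bil A (a *: x) y = a * bil A x y.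
Proof. by rewrite /bil !innerE -!scalemxAl mxE. Qed.

Lemma bilZr A (a : R) x y : bil A x (a *: y) = a * bil A x y.
Proof. by rewrite /bil !innerE linearZ -scalemxAr mxE. Qed.

Lemma bilNl A x y : bil A (- x) y = - bil A x y.
Proof. by rewrite -scaleN1r bilZl mulN1r. Qed.

Lemma bilNr A x y : bil A x (- y) = - bil A x y.
Proof. by rewrite -scaleN1r bilZr mulN1r. Qed.

Lemma bil0l A y : bil A 0 y = 0.
Proof. by rewrite -(scale0r 0) bilZl mul0r. Qed.

Lemma bil_suml A I (r : seq I) (P : pred I) (F : I -> 'rV[R]_m) y :
  bil A (\sum_(i <- r | P i) F i) y = \sum_(i <- r | P i) bil A (F i) y.
Proof. by elim/big_rec2: _ => [|i u v _ <-]; rewrite ?bil0l ?bilDl. Qed.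

Lemma bilE A x y : bil A x y = \sum_i \sum_j x ord0 j * A j i * y ord0 i.
Proof. by apply: eq_bigr => i _; rewrite mxE big_distrl. Qed.

Lemma bilC A x y : psd A -> bil A x y = bil A y x.
Proof.
move=> [sA _]; rewrite /bil inner_mulmx// /inner.
by apply: eq_bigr => i _; rewrite mulrC.
Qed.

Lemma bil_ge0 A x : psd A -> 0 <= bil A x x.
Proof. by move=> [_]; exact. Qed.

Lemma qnorm_ge0 A x : 0 <= qnorm A x.
Proof. exact: sqrtr_ge0. Qed.

Lemma sqr_qnorm A x : psd A -> qnorm A x ^+ 2 = bil A x x.
Proof. by move=> pA; rewrite sqr_sqrtr// bil_ge0. Qed.

Lemma qnorm_powR A x p : psd A -> qnorm A x `^ p = bil A x x `^ (p / 2).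
Proof.
by move=> pA; rewrite /qnorm -powR12_sqrt ?bil_ge0// -powRrM mulrC.
Qed.

Lemma qnormZ A (a : R) x : qnorm A (a *: x) = `|a| * qnorm A x.
Proof. by rewrite /qnorm bilZl bilZr mulrA -expr2 sqrtrM ?sqr_ge0// sqrtr_sqr. Qed.

Lemma qnormN A x : qnorm A (- x) = qnorm A x.
Proof. by rewrite -scaleN1r qnormZ normrN normr1 mul1r. Qed.

Lemma qnormBC A x y : qnorm A (x - y) = qnorm A (y - x).
Proof. by rewrite -opprB qnormN. Qed.

Lemma qnorm0 A : qnorm A 0 = 0.
Proof. by rewrite /qnorm bil0l sqrtr0. Qed.

(** Cauchy-Schwarz for a possibly degenerate form. If [y] is null, the form at [x + t *: y] is
    affine in [t] and nonnegative, so its slope vanishes; the chosen [t] would give it the value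
    -1. *)
Lemma bil_sqr_le A x y : psd A -> bil A x y ^+ 2 <= bil A x x * bil A y y.
Proof.
move=> pA; have [y0|yn0] := eqVneq (bil A y y) 0.
  rewrite y0 mulr0; have H (t : R) : 0 <= bil A x x + 2 * t * bil A x y.
    have := bil_ge0 (x + t *: y) pA.
    rewrite bilDl !bilDr !bilZl !bilZr y0 (bilC y x pA); lra.
  have [->|b0] := eqVneq (bil A x y) 0; first by rewrite expr0n.
  have := H (- (bil A x x + 1) / (2 * bil A x y)).
  have -> : 2 * (- (bil A x x + 1) / (2 * bil A x y)) * bil A x y = - (bil A x x + 1) by field.
  lra.
have yp : 0 < bil A y y by rewrite lt_neqAle eq_sym yn0 bil_ge0.
have := bil_ge0 (x - (bil A x y / bil A y y) *: y) pA.
rewrite bilDl !bilDr !bilNl !bilNr !bilZl !bilZr (bilC y x pA).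
have -> : bil A x x - bil A x y / bil A y y * bil A x y +
   (- (bil A x y / bil A y y * bil A x y) - - (bil A x y / bil A y y * (bil A x y / bil A y y * bil A y y)))
  = bil A x x - bil A x y ^+ 2 / bil A y y by field.
by rewrite subr_ge0 ler_pdivrMr.
Qed.

Lemma ler_bil_qnorm A x y : psd A -> `|bil A x y| <= qnorm A x * qnorm A y.
Proof.
move=> pA; rewrite -sqrtrM ?bil_ge0// -sqrtr_sqr ler_wsqrtr//.
exact: bil_sqr_le.
Qed.

Lemma ler_qnormD A x y : psd A -> qnorm A (x + y) <= qnorm A x + qnorm A y.
Proof.
move=> pA; rewrite -ler_sqr ?nnegrE ?addr_ge0 ?qnorm_ge0//.
rewrite sqrrD !sqr_qnorm// bilDl !bilDr (bilC y x pA).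
have := ler_bil_qnorm x y pA; rewrite ler_norml => /andP[_]; lra.
Qed.

Lemma qnorm_parallelogram A x y : psd A ->
  qnorm A (2^-1 *: (x + y)) ^+ 2 + qnorm A (x - y) ^+ 2 / 4 =
  (qnorm A x ^+ 2 + qnorm A y ^+ 2) / 2.
Proof.
move=> pA; rewrite !sqr_qnorm// bilZl bilZr !bilDl !bilDr !bilNl !bilNr.
by rewrite (bilC y x pA); field.
Qed.

Lemma ler_qnorm_half A x y : psd A ->
  qnorm A (2^-1 *: (x + y)) <= (qnorm A x + qnorm A y) / 2.
Proof.
move=> pA; rewrite qnormZ ger0_norm// mulrC ler_pM2r//; exact: ler_qnormD.
Qed.

Lemma ler_qnormB A x y : psd A -> qnorm A (x - y) <= qnorm A x + qnorm A y.
Proof. by move=> pA; rewrite (le_trans (ler_qnormD _ _ _))// qnormN. Qed.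

Lemma ler_qnorm_sum A (k : nat) (F : 'I_k -> 'rV[R]_m) : psd A ->
  qnorm A (\sum_i F i) <= \sum_i qnorm A (F i).
Proof.
move=> pA; elim/big_rec2: _ => [|i u v _ uv]; first by rewrite qnorm0.
by rewrite (le_trans (ler_qnormD _ _ _))// lerD2l.
Qed.

(* With [powR], the coefficient of a null vector is [0]. *)
Definition gs_coef A x b : R := bil A x b * bil A b b `^ (-1).

Lemma gs_coefP A x b : psd A -> gs_coef A x b * bil A b b = bil A x b.
Proof.
move=> pA; rewrite /gs_coef; have [b0|b0] := eqVneq (bil A b b) 0.
  rewrite b0 mulr0; apply/esym/eqP.
  by rewrite -sqrf_eq0 eq_le sqr_ge0 andbT (le_trans (bil_sqr_le _ _ pA))// b0 mulr0.
by rewrite powR_inv1 ?bil_ge0// divfK.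
Qed.

Lemma ler_gs_coef A x b : psd A -> `|gs_coef A x b| * qnorm A b <= qnorm A x.
Proof.
move=> pA; have [b0|b0] := eqVneq (qnorm A b) 0; first by rewrite b0 mulr0 qnorm_ge0.
have bp : 0 < qnorm A b by rewrite lt_neqAle eq_sym b0 qnorm_ge0.
rewrite -(ler_pM2r bp) -mulrA -expr2 sqr_qnorm//.
by rewrite -[X in _ * X](ger0_norm (bil_ge0 b pA)) -normrM gs_coefP// ler_bil_qnorm.
Qed.

Definition gs_proj A (k : nat) (b : nat -> 'rV[R]_m) x :=
  \sum_(j < k) gs_coef A x (b j) *: b j.

Definition orthogonal_upto A (k : nat) (b : nat -> 'rV[R]_m) :=
  forall i j, (i < k)%N -> (j < k)%N -> i != j -> bil A (b i) (b j) = 0.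

Lemma gs_proj_orthogonal A k (b : nat -> 'rV[R]_m) x i : psd A -> orthogonal_upto A k b -> (i < k)%N ->
  bil A (x - gs_proj A k b x) (b i) = 0.
Proof.
move=> pA ob ik; rewrite bilDl bilNl bil_suml (bigD1 (Ordinal ik))//= big1.
  by rewrite addr0 bilZl gs_coefP// subrr.
by move=> j ji; rewrite bilZl ob ?mulr0//.
Qed.

Lemma gs_proj_null A (b : nat -> 'rV[R]_m) x : psd A -> orthogonal_upto A m b ->
  (forall r, (forall i, (i < m)%N -> bil A r (b i) = 0) -> bil A r r = 0) ->
  qnorm A (x - gs_proj A m b x) = 0.
Proof.
move=> pA ob sb; rewrite /qnorm sb ?sqrtr0// => i im; exact: gs_proj_orthogonal.
Qed.

End qnorm.

(** * Measurable Gram-Schmidt fields for a degenerate form *)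

Section gram_schmidt.
Context d (T : measurableType d) {R : realType} {m : nat}.
Variables (D : set T) (S : T -> 'M[R]_m).
Hypothesis mS : forall i j, measurable_fun D (fun x => S x i j).
Hypothesis pS : forall x, D x -> psd (S x).

Definition coor_measurable (a : T -> 'rV[R]_m) :=
  forall i, measurable_fun D (fun x => a x ord0 i).

Lemma measurable_bil a b : coor_measurable a -> coor_measurable b ->
  measurable_fun D (fun x => bil (S x) (a x) (b x)).
Proof.
move=> ma mb; under eq_fun do rewrite bilE.
apply: measurable_sum => i; apply: measurable_sum => j.
by apply: measurable_funM => //; apply: measurable_funM.
Qed.

Lemma measurable_gs_coef a b : coor_measurable a -> coor_measurable b ->
  measurable_fun D (fun x => gs_coef (S x) (a x) (b x)).
Proof.
move=> ma mb; apply: measurable_funM; first exact: measurable_bil.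
by apply: (measurableT_comp (measurable_powR _)); exact: measurable_bil.
Qed.

Lemma coor_measurable_sum (k : nat) (a : 'I_k -> T -> 'rV[R]_m) (c : 'I_k -> T -> R) :
  (forall i, coor_measurable (a i)) -> (forall i, measurable_fun D (c i)) ->
  coor_measurable (fun x => \sum_i c i x *: a i x).
Proof.
move=> ma mc j; under eq_fun do (rewrite summxE; under eq_bigr do rewrite mxE).
by apply: measurable_sum => i; apply: measurable_funM => //; exact: ma.
Qed.

Lemma coor_measurableB a b : coor_measurable a -> coor_measurable b ->
  coor_measurable (fun x => a x - b x).
Proof. by move=> ma mb i; under eq_fun do rewrite !mxE; apply: measurable_funB. Qed.

Lemma coor_measurableD a b : coor_measurable a -> coor_measurable b ->
  coor_measurable (fun x => a x + b x).
Proof. by move=> ma mb i; under eq_fun do rewrite !mxE; apply: measurable_funD. Qed.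

Lemma coor_measurableZ (c : R) a : coor_measurable a -> coor_measurable (fun x => c *: a x).
Proof. by move=> ma i; under eq_fun do rewrite !mxE; apply: measurable_funM. Qed.

Lemma measurable_qnorm_powR p a : measurable D -> coor_measurable a ->
  measurable_fun D (fun x => qnorm (S x) (a x) `^ p).
Proof.
move=> mD ma; apply: (@eq_measurable_fun _ _ _ _ _ (fun x => bil (S x) (a x) (a x) `^ (p / 2))).
  by move=> x; rewrite inE => Dx; rewrite qnorm_powR//; exact: pS.
by apply: (measurableT_comp (measurable_powR _)); exact: measurable_bil.
Qed.

(** The standard basis is orthogonalized for [S x]. The fields may become null vectors, where
    [gs_coef] is 0, so one formula covers every rank and measurability is inherited. The last clause
    plays the role of equality of spans, up to null vectors. *)
Lemma gram_schmidt_step k : (k <= m)%N -> exists b : nat -> T -> 'rV[R]_m,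
  [/\ forall j, coor_measurable (b j),
      forall x, D x -> orthogonal_upto (S x) k (b ^~ x) &
      forall x r, D x -> (forall i, (i < k)%N -> bil (S x) r (b i x) = 0) ->
        forall i : 'I_m, (i < k)%N -> bil (S x) r (delta_mx ord0 i) = 0].
Proof.
elim: k => [_|k IH km].
  exists (fun _ _ => 0); split => //.
  by move=> j i; under eq_fun do rewrite mxE; exact: measurable_cst.
have [b [mb ob sb]] := IH (ltnW km).
pose e : 'rV[R]_m := delta_mx ord0 (Ordinal km).
have me : coor_measurable (fun=> e) by move=> i; exact: measurable_cst.
pose bk x := e - gs_proj (S x) k (b ^~ x) e.
exists (fun j x => if (j < k)%N then b j x else bk x); split.
- move=> j; have [jk|jk] := ltnP j k; first exact: mb.
  apply: coor_measurableB => //; apply: coor_measurable_sum => i; first exact: mb.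
  exact: measurable_gs_coef.
- move=> x Dx i j; rewrite !ltnS leq_eqVlt => /predU1P[->|ik].
    rewrite ltnn leq_eqVlt => /predU1P[->|jk]; first by rewrite eqxx.
    by rewrite jk => _; apply: gs_proj_orthogonal => //; [exact: pS|exact: ob].
  rewrite ik leq_eqVlt => /predU1P[->|jk].
    rewrite ltnn => _; rewrite bilC; last exact: pS.
    by apply: gs_proj_orthogonal => //; [exact: pS|exact: ob].
  by rewrite jk; exact: ob.
- move=> x r Dx rb i; rewrite ltnS leq_eqVlt => /predU1P[ik|ik]; last first.
    apply: sb => // j jk; have := rb j; rewrite jk; apply; exact: ltnW.
  have -> : delta_mx ord0 i = bk x + gs_proj (S x) k (b ^~ x) e.
    by rewrite subrK /e; congr delta_mx; exact: val_inj.
  have psx := pS Dx.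
  rewrite bilDr; have := rb k; rewrite ltnn ltnSn => ->//; rewrite add0r.
  rewrite bilC// bil_suml big1// => j _; rewrite bilZl bilC//.
  by have := rb j; rewrite ltn_ord => ->; rewrite ?mulr0// ltnW// ltnS ltn_ord.
Qed.

(** The remainder is orthogonal to all the fields, hence to all basis vectors, hence to itself. *)
Lemma gram_schmidt : exists b : nat -> T -> 'rV[R]_m,
  (forall j, coor_measurable (b j)) /\
  forall x, D x -> forall a, qnorm (S x) (a - gs_proj (S x) m (b ^~ x) a) = 0.
Proof.
have [b [mb ob sb]] := gram_schmidt_step (leqnn m).
exists b; split => // x Dx a; apply: gs_proj_null; [exact: pS|exact: ob|].
move=> r rb; have psx := pS Dx.
rewrite [X in bil _ _ X]row_sum_delta bilC// bil_suml big1// => i _.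
by rewrite bilZl bilC// (sb x r Dx rb)// mulr0.
Qed.

End gram_schmidt.

(** * Limits of rapidly converging sequences in the degenerate seminorm *)

Section fast_sequences.
Context {R : realType} {m : nat}.
Variables (A : 'M[R]_m) (a : nat -> 'rV[R]_m) (M : R).
Hypothesis pA : psd A.
Hypothesis M0 : 0 <= M.
Hypothesis aM : forall l, qnorm A (a l.+1 - a l) <= M * 2^-1 ^+ l.

Lemma qnorm_fast_cauchy k l : (k <= l)%N -> qnorm A (a l - a k) <= 2 * M * 2^-1 ^+ k.
Proof.
(* Subtracting the remaining tail makes the bound strong enough for induction on [l - k]. *)
move=> kl; rewrite (@le_trans _ _ (2 * M * 2^-1 ^+ k - 2 * M * 2^-1 ^+ l))//; last first.
  by rewrite gerBl mulr_ge0// ?mulr_ge0// exprn_ge0.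
rewrite -(subnK kl); elim: (l - k)%N => [|i IH].
  by rewrite add0n subrr qnorm0 subrr.
rewrite addSn (_ : _ - _ = (a (i + k).+1 - a (i + k)%N) + (a (i + k)%N - a k)); last by rewrite addrA subrK.
rewrite (le_trans (ler_qnormD _ _ pA))//.
have := aM (i + k)%N; rewrite [in X in _ -> X]exprS.
by move: IH; move: (2^-1 ^+ (i + k)) (qnorm _ _) (qnorm _ _) (2^-1 ^+ k) => x y z w; lra.
Qed.

(** The coefficient along a non-null vector is Lipschitz for the seminorm, hence Cauchy along the
    sequence; along a null vector it is constantly 0. *)
Lemma cvg_gs_coef b : cvg (gs_coef A (a l) b @[l --> \oo]).
Proof.
have [b0|b0] := eqVneq (bil A b b) 0.
  rewrite (_ : (fun l => _) = cst 0); first exact: is_cvg_cst.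
  by apply/funext => l; rewrite /gs_coef b0 powR0 ?mulr0// oppr_eq0 oner_eq0.
have nb : 0 < qnorm A b.
  by rewrite lt_neqAle eq_sym qnorm_ge0 andbT; apply: contra b0 => /eqP b0; rewrite -sqr_qnorm// b0 expr0n.
apply/cauchy_cvgP; apply: cauchy_exP => e /= e0.
have : geometric (2 * M / qnorm A b) 2^-1 @ \oo --> (0 : R).
  by apply: cvg_geometric; rewrite ger0_norm// invf_lt1// ltr1n.
move=> /cvgrPdist_lt /(_ _ e0) [N _ NP].
exists (gs_coef A (a N) b); exists N => // l /= Nl; rewrite /ball /=.
apply: le_lt_trans (NP N (leqnn N)); rewrite sub0r normrN distrC.
rewrite [leRHS]ger0_norm; last by rewrite mulr_ge0 ?exprn_ge0// divr_ge0 ?mulr_ge0// ltW.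
rewrite /geometric /= mulrAC ler_pdivlMr// (_ : _ - _ = gs_coef A (a l - a N) b).
  by rewrite (le_trans (ler_gs_coef _ _ pA))// qnorm_fast_cauchy.
by rewrite /gs_coef bilDl bilNl mulrBl.
Qed.

(** Split the difference into [a k - a l], the null remainder of [a l] after projection, and the
    error of the coefficients; then let [l] tend to infinity. *)
Lemma qnorm_gs_limit (b : nat -> 'rV[R]_m) (c : nat -> R) k :
  (forall x, qnorm A (x - gs_proj A m b x) = 0) ->
  (forall j, gs_coef A (a l) (b j) @[l --> \oo] --> c j) ->
  qnorm A (a k - \sum_(j < m) c j *: b j) <= 2 * M * 2^-1 ^+ k.
Proof.
move=> nb ca.
have H l : (k <= l)%N -> qnorm A (a k - \sum_(j < m) c j *: b j) <=
    2 * M * 2^-1 ^+ k + \sum_(j < m) `|gs_coef A (a l) (b j) - c j| * qnorm A (b j).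
  move=> kl.
  have -> : a k - \sum_(j < m) c j *: b j = (a k - a l) +
     ((a l - gs_proj A m b (a l)) + \sum_(j < m) (gs_coef A (a l) (b j) - c j) *: b j).
    have -> : \sum_(j < m) (gs_coef A (a l) (b j) - c j) *: b j =
        gs_proj A m b (a l) - \sum_(j < m) c j *: b j.
      by rewrite /gs_proj -sumrB; apply: eq_bigr => j _; rewrite scalerBl.
    by rewrite !addrA !subrK.
  rewrite (le_trans (ler_qnormD _ _ pA))// lerD//.
    by rewrite qnormBC qnorm_fast_cauchy.
  rewrite (le_trans (ler_qnormD _ _ pA))// nb add0r.
  by rewrite (le_trans (ler_qnorm_sum _ pA))//; apply: ler_sum => j _; rewrite qnormZ.
apply/ler_addgt0Pr => e e0.
have cv : (fun l => \sum_(j < m) `|gs_coef A (a l) (b j) - c j| * qnorm A (b j)) @ \oo --> (0 : R).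
  rewrite [X in _ --> X](_ : 0 = \sum_(j < m) 0 * qnorm A (b j)); last first.
    by rewrite big1// => j _; rewrite mul0r.
  apply: cvg_big => [|j _]; first exact: add_continuous.
  apply: cvgMr_tmp.
  rewrite -[X in _ --> X](@normr0 _ R); apply: cvg_norm.
  by rewrite -(subrr (c j)); apply: cvgB => //; exact: cvg_cst.
move: cv => /cvgrPdist_lt /(_ _ e0)[N _ NP].
rewrite (le_trans (H (maxn k N) (leq_maxl _ _)))// lerD2l.
have := NP (maxn k N) (leq_maxr _ _).
by rewrite sub0r normrN => /ltW/(le_trans (ler_norm _)).
Qed.

End fast_sequences.

Section LpQ_complete.
Context d (T : measurableType d) {R : realType} {m : nat}.
Variables (mu : {measure set T -> \bar R}) (D : set T) (S : T -> 'M[R]_m) (p : R).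
Hypothesis mD : measurable D.
Hypothesis mS : forall i j, measurable_fun D (fun x => S x i j).
Hypothesis pS : forall x, D x -> psd (S x).
Hypothesis p0 : 0 < p.
Local Open Scope ereal_scope.

(** Riesz-Fischer. Weighting the p-th powers of the increments by [(2 ^+ l) ^ p] gives a series
    [Phi] of integral at most 1, hence finite almost everywhere. Where it is finite, the sequence is
    fast with constant [M = Phi ^ (1/p)], and [qnorm_gs_limit] gives a pointwise bound that
    integrates to the claim. *)
Lemma LpQ_fast_limit (a : nat -> T -> 'rV[R]_m) : (forall l, coor_measurable D (a l)) ->
  (forall l, \int[mu]_(x in D) (qnorm (S x) (a l.+1 x - a l x) `^ p)%:E <=
    ((2^-1 ^+ l) `^ p / (2 ^ l.+1)%:R)%:E) ->
  exists2 g, coor_measurable D g &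
    forall k, \int[mu]_(x in D) (qnorm (S x) (a k x - g x) `^ p)%:E <=
      ((2 * 2^-1 ^+ k) `^ p)%:E.
Proof.
move=> ma Ha.
pose F l x := qnorm (S x) (a l.+1 x - a l x).
have mF l : measurable_fun D (fun x => F l x `^ p)%R.
  by apply: measurable_qnorm_powR => //; exact: coor_measurableB.
pose Phi x := \sum_(l <oo) ((2 ^+ l) `^ p * F l x `^ p)%:E.
have F0 l x : 0 <= ((2 ^+ l) `^ p * F l x `^ p)%:E.
  by rewrite lee_fin mulr_ge0// powR_ge0.
have mF' l : measurable_fun D (fun x => ((2 ^+ l) `^ p * F l x `^ p)%:E).
  by apply/measurable_EFinP; apply: measurable_funM.
have mPhi : measurable_fun D Phi.
  exact: (@ge0_emeasurable_sum _ _ _ _ (fun l x => ((2 ^+ l) `^ p * F l x `^ p)%:E) predT).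
have Phi0 x : 0 <= Phi x by apply: nneseries_ge0 => l _ _.
have iPhi : \int[mu]_(x in D) Phi x <= 1%:E.
  rewrite integral_nneseries//.
  have := @epsilon_trick R (fun=> 0) 1%R xpredT.
  have -> : \sum_(i <oo) (0 : \bar R) = 0 by apply: eseries0.
  rewrite add0e => /(_ (fun _ => lexx _) ler01)/=.
  apply: le_trans; apply: lee_nneseries => [l _ _|l _]; first exact: integral_ge0.
  under eq_integral do rewrite EFinM.
  rewrite ge0_integralZl_EFin ?powR_ge0//; last 2 first.
    by move=> x _; rewrite lee_fin powR_ge0.
    exact/measurable_EFinP.
  apply: (@le_trans _ _ (((2 ^+ l) `^ p)%:E * ((2^-1 ^+ l) `^ p / (2 ^ l.+1)%:R)%:E)).
    by apply: lee_wpmul2l; [rewrite lee_fin powR_ge0|exact: Ha].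
  rewrite -EFinM mulrA -powRM ?exprn_ge0// -exprMn divff// expr1n powR1E add0e lee_fin.
  exact: lexx.
have [b [mb nb]] := gram_schmidt mS pS.
(* An upper limit is measurable without any convergence, and is the limit wherever the coefficients
   converge. *)
pose c j x := fine (limn_esup (fun l => (gs_coef (S x) (a l x) (b j x))%:E)).
have mc j : measurable_fun D (c j).
  apply: (@measurableT_comp _ _ _ _ _ _ (fine : \bar R -> R)) => //.
  apply: (measurable_fun_limn_esup (f := fun l x => (gs_coef (S x) (a l x) (b j x))%:E)) => l.
  by apply/measurable_EFinP; exact: measurable_gs_coef.
pose g x := (\sum_(j < m) c j x *: b j x)%R.
have mg : coor_measurable D g by apply: coor_measurable_sum => j //; exact: mb.
exists g => // k.
have good x : D x -> Phi x \is a fin_num ->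
    (qnorm (S x) (a k x - g x) `^ p)%:E <= ((2 * 2^-1 ^+ k) `^ p)%:E * Phi x.
  move=> Dx Pf; pose M := (fine (Phi x) `^ p^-1)%R.
  have psx := pS Dx.
  have M0 : (0 <= M)%R by exact: powR_ge0.
  have aM l : (qnorm (S x) (a l.+1 x - a l x) <= M * 2^-1 ^+ l)%R.
    have : ((2 ^+ l) `^ p * F l x `^ p)%:E <= Phi x.
      have := @nneseries_lim_ge R (fun l => ((2 ^+ l) `^ p * F l x `^ p)%:E) xpredT 0%N l.+1.
      move=> /(_ (fun _ _ _ => F0 _ _)); apply: le_trans.
      by rewrite big_mkord big_ord_recr/= leeDr// sume_ge0.
    rewrite -[in leRHS](fineK Pf) lee_fin -powRM ?exprn_ge0 ?qnorm_ge0// => H.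
    have : (2 ^+ l * F l x <= M)%R.
      have -> : (2 ^+ l * F l x = ((2 ^+ l * F l x) `^ p) `^ p^-1)%R.
        by rewrite -powRrM mulfV ?gt_eqF// powRr1// mulr_ge0 ?exprn_ge0 ?qnorm_ge0.
      by rewrite ler_powR_nneg ?invr_ge0 ?(ltW p0) ?powR_ge0.
    by rewrite exprVn ler_pdivlMr ?exprn_gt0// mulrC.
  have cx j : gs_coef (S x) (a l x) (b j x) @[l --> \oo] --> c j x.
    have cv := @cvg_gs_coef _ _ _ (a ^~ x) M psx M0 aM (b j x).
    rewrite /c is_cvg_limn_esupE; last first.
      by move/cvg_ex : cv => [l cl]; apply/cvg_ex; exists l%:E; apply: cvg_EFin => //; exact: nearW.
    by rewrite EFin_lim//.
  have := @qnorm_gs_limit R m (S x) (a ^~ x) M psx M0 aM (b ^~ x) (c ^~ x) k (nb x Dx) cx.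
  rewrite -/(g x) => H; rewrite -[in leRHS](fineK Pf) -EFinM lee_fin.
  have -> : fine (Phi x) = (M `^ p)%R.
    by rewrite /M -powRrM mulVf ?gt_eqF// powRr1// fine_ge0.
  rewrite -powRM ?mulr_ge0 ?exprn_ge0// ler_powR_nneg ?(ltW p0) ?qnorm_ge0//.
  by rewrite mulrAC.
apply: (@le_trans _ _ (\int[mu]_(x in D) (((2 * 2^-1 ^+ k) `^ p)%:E * Phi x))).
  apply: ae_ge0_le_integral => //.
  - by move=> x _; rewrite lee_fin powR_ge0.
  - apply/measurable_EFinP; apply: measurable_qnorm_powR => //.
    exact: coor_measurableB.
  - by move=> x _; rewrite mule_ge0// lee_fin powR_ge0.
  - by apply: emeasurable_funM => //; exact: measurable_cst.
  - have : mu.-integrable D Phi.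
      apply/integrableP; split => //.
      under eq_integral => x _ do rewrite gee0_abs//.
      by rewrite (le_lt_trans iPhi)// ltry.
    move=> /(integrable_ae mD); apply: filterS => x H Dx.
    exact: good (H Dx).
rewrite ge0_integralZl_EFin ?powR_ge0// -[leRHS]mule1.
by apply: lee_wpmul2l => //; rewrite lee_fin powR_ge0.
Qed.

End LpQ_complete.

(** * The energy density *)

Section pointwise_energy.
Context {R : realType}.

Lemma psd_scalar1 m : psd (1%:M : 'M[R]_m).
Proof. by split=> [|x]; rewrite ?trmx1// mulmx1 inner_ge0. Qed.

Lemma bil_scalar1 (s t : R) : bil (1%:M : 'M[R]_1) s%:M t%:M = s * t.
Proof. by rewrite /bil mulmx1 /inner big_ord1 !mxE /= !mulr1n. Qed.

Lemma qnorm_scalar1 (s : R) : qnorm (1%:M : 'M[R]_1) s%:M = `|s|.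
Proof. by rewrite /qnorm bil_scalar1 -expr2 sqrtr_sqr. Qed.

Variables (n : nat) (p tau : R).
Hypotheses (p1 : 1 < p) (tau0 : 0 < tau).
Implicit Types (A : 'M[R]_n) (s t : R) (x y : 'rV[R]_n).

Let p0 : 0 < p. Proof. exact: lt_trans p1. Qed.

(** [K] is chosen before the dimension and the matrix, so one constant serves both for sqrt Q g and,
    in dimension 1, for u. *)
Lemma qnorm_uniform_convexity eps : 0 < eps -> exists2 K : R, 0 <= K &
  forall m (A : 'M[R]_m) (x y : 'rV[R]_m), psd A ->
  0 <= (qnorm A x `^ p + qnorm A y `^ p) / 2 - qnorm A (2^-1 *: (x + y)) `^ p /\
  qnorm A (x - y) `^ p <= eps * (qnorm A x `^ p + qnorm A y `^ p) +
    K * ((qnorm A x `^ p + qnorm A y `^ p) / 2 - qnorm A (2^-1 *: (x + y)) `^ p).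
Proof.
move=> /(powR_uniform_convexity p1)[K K0 H]; exists K => // m A x y pA.
apply: H; rewrite ?qnorm_ge0//; [exact: qnorm_parallelogram|exact: ler_qnorm_half|exact: ler_qnormB].
Qed.

Definition energy A s x : R := tau * `|s| `^ p + qnorm A x `^ p.

Lemma energy_ge0 A s x : 0 <= energy A s x.
Proof. by rewrite addr_ge0 ?powR_ge0// mulr_ge0 ?powR_ge0// ltW. Qed.

Lemma energyZ A (a : R) s x : energy A (a * s) (a *: x) = `|a| `^ p * energy A s x.
Proof.
by rewrite /energy normrM qnormZ !powRM ?qnorm_ge0// mulrDr mulrCA.
Qed.

Lemma energy_uniform_convexity eps : 0 < eps -> exists2 K : R, 0 <= K &
  forall A s t x y, psd A ->
  energy A (s - t) (x - y) <= eps * (energy A s x + energy A t y) +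
    K * ((energy A s x + energy A t y) / 2 - energy A (2^-1 * (s + t)) (2^-1 *: (x + y))).
Proof.
move=> /qnorm_uniform_convexity[K K0 H]; exists K => // A s t x y pA.
have [_ H2] := H _ A x y pA.
have [_] := H _ 1%:M s%:M t%:M (psd_scalar1 1).
rewrite -raddfB -raddfD -mul_scalar_mx -scalar_mxM !qnorm_scalar1 => H1.
rewrite /energy.
have {}H1 := ler_wpM2l (ltW tau0) H1.
move: H1 H2; set a1 := `|s| `^ _; set a2 := `|t| `^ _; set a3 := `|s - t| `^ _; set a4 := `|_ * _| `^ _.
move: (qnorm A x `^ p) (qnorm A y `^ p) (qnorm A _ `^ p) (qnorm A _ `^ p) => b1 b2 b3 b4.
nra.
Qed.

Lemma energyD_le eta : 0 < eta -> exists2 K : R, 0 <= K &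
  forall A s t x y, psd A ->
  energy A (s + t) (x + y) <= (1 + eta) * energy A s x + K * energy A t y.
Proof.
move=> /(powRD_le p0)[K K0 H]; exists K => // A s t x y pA.
have H1 : `|s + t| `^ p <= (1 + eta) * `|s| `^ p + K * `|t| `^ p.
  apply: le_trans (H _ _ (normr_ge0 s) (normr_ge0 t)).
  by rewrite ler_powR_nneg ?(ltW p0)// ler_normD.
have H2 : qnorm A (x + y) `^ p <= (1 + eta) * qnorm A x `^ p + K * qnorm A y `^ p.
  apply: le_trans (H _ _ (qnorm_ge0 A x) (qnorm_ge0 A y)).
  by rewrite ler_powR_nneg ?(ltW p0) ?qnorm_ge0// ler_qnormD.
rewrite /energy; have := ler_wpM2l (ltW tau0) H1; move: H2.
move: (`|s + t| `^ p) (`|s| `^ p) (`|t| `^ p) (qnorm A _ `^ p) (qnorm A _ `^ p) (qnorm A _ `^ p).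
move=> a1 a2 a3 b1 b2 b3; lra.
Qed.

Lemma young_energy eta : 0 < eta -> exists2 K : R, 0 <= K &
  forall A s x (f : R), `|f * s| <= eta * energy A s x + K * `|f| `^ (p / (p - 1)).
Proof.
move=> eta0; have [K K0 H] := young_powR p1 (mulr_gt0 eta0 tau0).
exists K => // A s x f; rewrite normrM mulrC.
rewrite (le_trans (H _ _ (normr_ge0 _) (normr_ge0 _)))// lerD2r -mulrA.
by rewrite ler_wpM2l ?(ltW eta0)// lerDl powR_ge0.
Qed.

(** Young's inequality with the small factor on [f], for use when the energy itself is small; the
    exponent conjugate to p/(p-1) is p. *)
Lemma young_energy_dual eta : 0 < eta -> exists2 K : R, 0 <= K &
  forall A s x (f : R), `|f * s| <= eta * `|f| `^ (p / (p - 1)) + K * energy A s x.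
Proof.
move=> eta0; have q0 : 0 < p - 1 by rewrite subr_gt0.
have q1 : 1 < p / (p - 1) by rewrite ltr_pdivlMr// mul1r gtrBl.
have [K K0 H] := young_powR q1 eta0.
exists (K / tau) => [|A s x f]; first by rewrite divr_ge0// ltW.
have qp : p / (p - 1) / (p / (p - 1) - 1) = p.
  have -> : p / (p - 1) - 1 = (p - 1)^-1 by field; rewrite gt_eqF.
  by rewrite invrK divfK// gt_eqF.
rewrite normrM (le_trans (H _ _ (normr_ge0 _) (normr_ge0 _)))// lerD2l qp.
rewrite -mulrA ler_wpM2l// mulrC ler_pdivlMr// mulrC lerDl powR_ge0//.
Qed.

End pointwise_energy.

Lemma convex_weights (R : realFieldType) (u x y : R) : 1 + u != 0 ->
  (1 + u) * ((1 - u / (1 + u)) * x + u / (1 + u) * y) = x + u * y.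
Proof. by move=> u0; field. Qed.

(** * Difference quotients of the p-th power of the seminorm *)

Section qnorm_difference_quotient.
Context {R : realType} {m : nat}.
Variables (p : R) (A : 'M[R]_m) (a b : 'rV[R]_m).
Hypotheses (p1 : 1 < p) (pA : psd A).

Let p0 : 0 < p. Proof. exact: lt_trans p1. Qed.

Lemma qnorm_powR_derivative :
  (fun k : nat => (qnorm A (a + k.+1%:R^-1 *: b) `^ p - qnorm A a `^ p) / k.+1%:R^-1)
   @ \oo --> p * (bil A a a `^ ((p - 2) / 2) * bil A a b).
Proof.
have := @powR_quadratic_derivative R p (bil A a a) (bil A a b) (bil A b b) p1
  (bil_ge0 a pA) (bil_ge0 b pA) (bil_sqr_le a b pA).
apply: cvg_trans; apply: near_eq_cvg; apply: nearW => k /=.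
rewrite !qnorm_powR// bilDl !bilDr !bilZl !bilZr (bilC b a pA).
congr ((_ `^ _ - _) / _).
by move: (k.+1%:R^-1) (bil A a a) (bil A a b) (bil A b b) => t x y z; ring.
Qed.

(** A majorant independent of [u], from convexity. The upper bound writes [a + u *: b] as a convex
    combination of [a] and [a + b]; the lower one writes [a] as a combination of [a + u *: b] and
    [a - b], the latter with weight [u / (1 + u)]. *)
Lemma qnorm_quotient_le (u : R) : 0 < u <= 1 ->
  `|(qnorm A (a + u *: b) `^ p - qnorm A a `^ p) / u| <=
  qnorm A (a + b) `^ p + qnorm A (a - b) `^ p + 2 * qnorm A a `^ p.
Proof.
move=> /andP[u0 u1].
have H1 : qnorm A (a + u *: b) `^ p <= (1 - u) * qnorm A a `^ p + u * qnorm A (a + b) `^ p.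
  have := @powR_convex R p u _ _ p1 _ (qnorm_ge0 A a) (qnorm_ge0 A (a + b)).
  rewrite (ltW u0) u1 => /(_ isT); apply: le_trans.
  rewrite ler_powR_nneg ?(ltW p0) ?qnorm_ge0//.
  have -> : a + u *: b = (1 - u) *: a + u *: (a + b).
    by rewrite scalerDr addrA -scalerDl subrK scale1r.
  by rewrite (le_trans (ler_qnormD _ _ pA))// !qnormZ !ger0_norm ?subr_ge0// ltW.
have H2 : (1 + u) * qnorm A a `^ p <= qnorm A (a + u *: b) `^ p + u * qnorm A (a - b) `^ p.
  have v0 : 0 < 1 + u by rewrite addr_gt0.
  pose v := u / (1 + u).
  have v01 : 0 <= v <= 1.
    apply/andP; split; first by apply: divr_ge0; exact: ltW.
    by rewrite /v ler_pdivrMr// mul1r lerDr ler01.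
  have := @powR_convex R p v _ _ p1 v01 (qnorm_ge0 A (a + u *: b)) (qnorm_ge0 A (a - b)).
  have : qnorm A a `^ p <= ((1 - v) * qnorm A (a + u *: b) + v * qnorm A (a - b)) `^ p.
    rewrite ler_powR_nneg ?(ltW p0) ?qnorm_ge0//.
    have {1}-> : a = (1 - v) *: (a + u *: b) + v *: (a - b).
      rewrite !scalerDr scalerN addrACA -scalerDl subrK scale1r scalerA -scalerBl.
      rewrite (_ : (1 - v) * u - v = 0) ?scale0r ?addr0//.
      by rewrite /v; field; rewrite gt_eqF.
    have /andP[v0' v1'] := v01.
    by rewrite (le_trans (ler_qnormD _ _ pA))// !qnormZ !ger0_norm ?subr_ge0.
  move=> h /(le_trans h); rewrite -(ler_pM2l v0).
  have -> : (1 + u) * ((1 - v) * qnorm A (a + u *: b) `^ p + v * qnorm A (a - b) `^ p) =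
    qnorm A (a + u *: b) `^ p + u * qnorm A (a - b) `^ p.
    by apply: convex_weights; rewrite gt_eqF.
  exact.
move: H1 H2 (powR_ge0 (qnorm A (a + b)) p) (powR_ge0 (qnorm A (a - b)) p) (powR_ge0 (qnorm A a) p).
move: (qnorm A (a + u *: b) `^ p) (qnorm A a `^ p) (qnorm A (a + b) `^ p) (qnorm A (a - b) `^ p).
move=> X Y Z W H1 H2 Z0 W0 Y0.
rewrite normrM normfV (gtr0_norm u0) ler_pdivrMr// ler_norml; apply/andP; split; nra.
Qed.

End qnorm_difference_quotient.

(** * The variational problem *)

Section real_integrable.
Context d (T : measurableType d) {R : realType} (mu : {measure set T -> \bar R}).
Variable D : set T.
Hypothesis mD : measurable D.
Implicit Types f g : T -> R.

Lemma real_integrable_lin f g (a b : R) :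
  mu.-integrable D (EFin \o f) -> mu.-integrable D (EFin \o g) ->
  mu.-integrable D (EFin \o (fun x => a * f x + b * g x)).
Proof.
move=> fi gi; rewrite (_ : _ \o _ = (fun x => a%:E * (EFin \o f) x) \+ (fun x => b%:E * (EFin \o g) x))%E.
  by apply: integrableD => //; exact: integrableZl.
by apply/funext => x; rewrite /= EFinD !EFinM.
Qed.

Lemma Rintegral_lin f g (a b : R) :
  mu.-integrable D (EFin \o f) -> mu.-integrable D (EFin \o g) ->
  \int[mu]_(x in D) (a * f x + b * g x) =
  a * \int[mu]_(x in D) f x + b * \int[mu]_(x in D) g x.
Proof.
move=> fi gi; have zi (c : R) (h : T -> R) : mu.-integrable D (EFin \o h) ->
    mu.-integrable D (EFin \o (fun x => c * h x)).
  move=> hi; rewrite (_ : _ \o _ = fun x => c%:E * (EFin \o h) x)%E; first exact: integrableZl.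
  by apply/funext => x; rewrite /= EFinM.
by rewrite RintegralD ?RintegralZl//; exact: zi.
Qed.

Lemma real_le_integrable f g : measurable_fun D f -> (forall x, D x -> `|f x| <= g x) ->
  mu.-integrable D (EFin \o g) -> mu.-integrable D (EFin \o f).
Proof.
move=> mf fg; apply: le_integrable => //; first exact/measurable_EFinP.
by move=> x Dx /=; rewrite lee_fin (le_trans (fg x Dx))// ler_norm.
Qed.

Lemma ler_Rintegral_lin f g h (a b : R) :
  mu.-integrable D (EFin \o f) ->
  mu.-integrable D (EFin \o g) -> mu.-integrable D (EFin \o h) ->
  (forall x, D x -> f x <= a * g x + b * h x) ->
  \int[mu]_(x in D) f x <= a * \int[mu]_(x in D) g x + b * \int[mu]_(x in D) h x.
Proof.
move=> fi gi hi fgh; rewrite -Rintegral_lin//; apply: le_Rintegral => //.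
exact: real_integrable_lin.
Qed.

Lemma EFin_Rintegral (f : T -> R) : mu.-integrable D (EFin \o f) ->
  (\int[mu]_(x in D) (f x)%:E)%E = (\int[mu]_(x in D) f x)%:E.
Proof. by move=> fi; rewrite fineK//; exact: integrable_fin_num fi. Qed.

End real_integrable.

(** The arithmetic of [functional_continuous]: [a + b] and [f + c] are the functional at [v] and at
    [w], each as energy over p plus load. *)
Lemma error_budget (R : realFieldType) (a b c f g h i j k y : R) :
  a <= f + k + j -> b - c <= g + h -> i + g <= y / 2 -> j + h <= y / 2 -> k <= i ->
  a + b <= f + c + y.
Proof. lra. Qed.

Section derivative.
Context d (T : measurableType d) {R : realType} {m : nat}.
Variables (mu : {measure set T -> \bar R}) (D : set T) (S : T -> 'M[R]_m) (p : R).
Hypothesis mD : measurable D.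
Hypothesis mS : forall i j, measurable_fun D (fun x => S x i j).
Hypothesis pS : forall x, D x -> psd (S x).
Hypothesis p1 : 1 < p.
Variables a b : T -> 'rV[R]_m.
Hypotheses (ma : coor_measurable D a) (mb : coor_measurable D b).
Hypothesis ia : mu.-integrable D (EFin \o (fun x => qnorm (S x) (a x) `^ p)).
Hypothesis iab : mu.-integrable D (EFin \o (fun x => qnorm (S x) (a x + b x) `^ p)).
Hypothesis iaBb : mu.-integrable D (EFin \o (fun x => qnorm (S x) (a x - b x) `^ p)).

Let quot (k : nat) x : R :=
  (qnorm (S x) (a x + k.+1%:R^-1 *: b x) `^ p - qnorm (S x) (a x) `^ p) / k.+1%:R^-1.

Let lim_quot x : R :=
  p * (bil (S x) (a x) (a x) `^ ((p - 2) / 2) * bil (S x) (a x) (b x)).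

Lemma qnorm_powR_derivative_integral :
  mu.-integrable D (EFin \o (fun x =>
     bil (S x) (a x) (a x) `^ ((p - 2) / 2) * bil (S x) (a x) (b x))) /\
  (fun k : nat => \int[mu]_(x in D) quot k x) @ \oo -->
    p * \int[mu]_(x in D) (bil (S x) (a x) (a x) `^ ((p - 2) / 2) * bil (S x) (a x) (b x)).
Proof.
have p0 : 0 < p by rewrite (lt_trans ltr01).
have mq k : measurable_fun D (quot k).
  apply: measurable_funM => //; apply: measurable_funB; apply: measurable_qnorm_powR => //.
  by apply: coor_measurableD => //; exact: coor_measurableZ.
have ml : measurable_fun D lim_quot.
  apply: measurable_funM => //; apply: measurable_funM; last exact: measurable_bil.
  by apply: (measurableT_comp (measurable_powR _)); exact: measurable_bil.
have ig := real_integrable_lin mD 1 2 (real_integrable_lin mD 1 1 iab iaBb) ia.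
have [il _ cl] : [/\ mu.-integrable D (EFin \o lim_quot),
   [sequence (\int[mu]_(x in D) `|(quot n x)%:E - (lim_quot x)%:E|)%E]_n @ \oo --> 0%E &
   [sequence (\int[mu]_(x in D) (quot n x)%:E)%E]_n @ \oo --> (\int[mu]_(x in D) (lim_quot x)%:E)%E].
  apply: (dominated_convergence mD _ _ _ ig).
  - by move=> k; apply/measurable_EFinP.
  - exact/measurable_EFinP.
  - apply: aeW => x Dx; apply: cvg_EFin; first exact: nearW.
    exact: qnorm_powR_derivative (pS Dx).
  - apply: aeW => x k Dx /=; rewrite lee_fin !mul1r.
    apply: (@qnorm_quotient_le _ _ _ _ _ _ p1 (pS Dx)).
    by rewrite invr_gt0 ltr0n /= invf_le1 ?ltr0n// ler1n.
have il' : mu.-integrable D (EFin \o (fun x =>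
     bil (S x) (a x) (a x) `^ ((p - 2) / 2) * bil (S x) (a x) (b x))).
  have := real_integrable_lin mD p^-1 0 il il.
  apply: eq_integrable => // x _ /=.
  by rewrite mul0r addr0 mulKf// gt_eqF.
split => //; rewrite -RintegralZl//.
apply: fine_cvg; rewrite fineK; last exact: integrable_fin_num il.
exact: cl.
Qed.

End derivative.

(** Here [a], [b], [c] are the energies of two competitors and of their midpoint, [l] and [k] the
    two loads, [m] the infimum and [y] the excess over it. *)
Lemma midpoint_budget (R : realFieldType) (q a b c l k m y : R) : 0 < q ->
  a / q + l <= m + y -> b / q + k <= m + y -> m <= c / q + (2^-1 * l + 2^-1 * k) ->
  (a + b) / 2 - c <= q * y.
Proof.
move=> q0 ha hb hc; rewrite -ler_pdivrMl// mulrC mulrBl mulrAC mulrDl.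
move: ha hb hc; move: (a / q) (b / q) (c / q) => a' b' c'; lra.
Qed.

Lemma cauchy_budget (R : realFieldType) (a b c e e1 L t y : R) : 0 <= L ->
  t <= e1 * (1 * a + 1 * b) + L * (2^-1 * (1 * a + 1 * b) + (-1) * c) ->
  (a + b) / 2 - c <= y -> e1 * (a + b) <= e / 2 -> L * y <= e / 2 -> t <= e.
Proof.
move=> L0; rewrite !mul1r mulN1r [2^-1 * _]mulrC => H1 H2 H3 H4.
apply: (le_trans H1); rewrite [leRHS]splitr; apply: lerD => //.
exact: le_trans (ler_wpM2l L0 H2) H4.
Qed.

Lemma difference_quotient_ge0 (R : realFieldType) (q t c a a' b b' l k : R) :
  0 < q -> 0 < t ->
  (c * a + b) / q + l <= (c * a' + b') / q + (l + t * k) ->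
  0 <= (c * ((a' - a) / t) + (b' - b) / t) / q + k.
Proof.
move=> q0 t0 H; have -> : (c * ((a' - a) / t) + (b' - b) / t) / q + k =
  ((c * a' + b') / q + (l + t * k) - ((c * a + b) / q + l)) / t.
  by field; rewrite !gt_eqF.
by rewrite divr_ge0 ?subr_ge0// ltW.
Qed.

(** * Minimization over an abstract linear space of competitors, and the Euler-Lagrange equation *)

Section variational.
Context d (T : measurableType d) {R : realType} {n : nat}.
Variables (mu : {measure set T -> \bar R}) (D : set T) (Q : T -> 'M[R]_n).
Variables (p tau : R) (phi : T -> R).
Hypothesis mD : measurable D.
Hypothesis mQ : forall i j, measurable_fun D (fun x => Q x i j).
Hypothesis pQ : forall x, D x -> psd (Q x).
Hypotheses (p1 : 1 < p) (tau0 : 0 < tau).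
Hypothesis mphi : measurable_fun D phi.
Hypothesis iphi : mu.-integrable D (EFin \o (fun x => `|phi x| `^ (p / (p - 1)))).

Let p0 : 0 < p. Proof. exact: lt_trans p1. Qed.

Definition fun_pair : Type := ((T -> R) * (T -> 'rV[R]_n))%type.
Implicit Types w v : fun_pair.

Definition lincomb (a : R) w (b : R) v : fun_pair :=
  (fun x => a * w.1 x + b * v.1 x, fun x => a *: w.2 x + b *: v.2 x).

Definition energy_at w x : R := energy p tau (Q x) (w.1 x) (w.2 x).

Definition admissible w := [/\ measurable_fun D w.1, coor_measurable D w.2 &
  mu.-integrable D (EFin \o energy_at w)].

Definition total_energy w : R := \int[mu]_(x in D) energy_at w x.

Definition load w : R := \int[mu]_(x in D) (phi x * w.1 x).

Definition functional w : R := total_energy w / p + load w.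

Let Psi : R := \int[mu]_(x in D) (`|phi x| `^ (p / (p - 1))).

Lemma energy_at_ge0 w x : 0 <= energy_at w x.
Proof. exact: energy_ge0. Qed.

Lemma total_energy_ge0 w : 0 <= total_energy w.
Proof. by apply: Rintegral_ge0 => x _; exact: energy_at_ge0. Qed.

Lemma measurable_energy_at w : measurable_fun D w.1 -> coor_measurable D w.2 ->
  measurable_fun D (energy_at w).
Proof.
move=> m1 m2; apply: measurable_funD; last exact: measurable_qnorm_powR.
apply: measurable_funM => //; apply: (measurableT_comp (measurable_powR _)).
exact: measurableT_comp.
Qed.

Lemma measurable_lincomb1 a w b v : measurable_fun D w.1 -> measurable_fun D v.1 ->
  measurable_fun D (lincomb a w b v).1.
Proof. by move=> mw mv; apply: measurable_funD; apply: measurable_funM. Qed.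

Lemma measurable_lincomb2 a w b v : coor_measurable D w.2 -> coor_measurable D v.2 ->
  coor_measurable D (lincomb a w b v).2.
Proof. by move=> mw mv; apply: coor_measurableD; exact: coor_measurableZ. Qed.

Lemma admissible_lincomb a w b v : admissible w -> admissible v ->
  admissible (lincomb a w b v).
Proof.
move=> [w1 w2 iw] [v1 v2 iv].
have m1 := measurable_lincomb1 a b w1 v1; have m2 := measurable_lincomb2 a b w2 v2.
split; [exact: m1|exact: m2|]; have [K K0 H] := @energyD_le R n p tau p1 tau0 1 ltr01.
apply: (@real_le_integrable _ _ _ mu D mD _
  (fun x => (1 + 1) * `|a| `^ p * energy_at w x + K * `|b| `^ p * energy_at v x)).
- exact: measurable_energy_at.
- move=> x Dx; rewrite ger0_norm ?energy_at_ge0// -!mulrA -!energyZ//.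
  by apply: H; exact: pQ.
- exact: real_integrable_lin.
Qed.

Lemma integrable_load w : admissible w -> mu.-integrable D (EFin \o (fun x => phi x * w.1 x)).
Proof.
move=> [w1 w2 iw]; have [K K0 H] := @young_energy R n p tau p1 tau0 1 ltr01.
apply: (@real_le_integrable _ _ _ mu D mD _
  (fun x => 1 * energy_at w x + K * `|phi x| `^ (p / (p - 1)))).
- exact: measurable_funM.
- by move=> x Dx; exact: H.
- exact: real_integrable_lin.
Qed.

Lemma load_lincomb a w b v : admissible w -> admissible v ->
  load (lincomb a w b v) = a * load w + b * load v.
Proof.
move=> aw av; rewrite /load -Rintegral_lin//; try exact: integrable_load.
by apply: eq_Rintegral => x _ /=; ring.
Qed.

(** Young's inequality with factor [1 / (2 p)] absorbs the load into half of the term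
    [total_energy w / p]. *)
Lemma functional_coercive : exists C : R, forall w, admissible w ->
  total_energy w <= 2 * p * (functional w + C).
Proof.
have [K K0 H] := @young_energy R n p tau p1 tau0 (2 * p)^-1 ltac:(by rewrite invr_gt0 mulr_gt0).
exists (K * Psi) => w aw; have [w1 w2 iw] := aw.
have := @ler_Rintegral_lin _ _ _ mu D mD
  (fun x => -1 * (phi x * w.1 x) + 0 * (phi x * w.1 x)) _ _ (2 * p)^-1 K _ iw iphi.
have il := integrable_load aw.
move=> /(_ (real_integrable_lin mD _ _ il il)) L.
have {}L : - load w <= (2 * p)^-1 * total_energy w + K * Psi.
  rewrite Rintegral_lin// mulN1r mul0r addr0 in L; apply: L => x Dx.
  rewrite mulN1r mul0r addr0 (le_trans _ (H (Q x) (w.1 x) (w.2 x) (phi x)))//.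
  by rewrite -normrN ler_norm.
rewrite -ler_pdivrMl ?mulr_gt0// /functional.
have -> : total_energy w / p = 2 * ((2 * p)^-1 * total_energy w) by field; rewrite gt_eqF.
by move: L; move: (_ * total_energy w) (load w) (K * Psi) => x y z; lra.
Qed.

(** Write v = w + z. [energyD_le] and [young_energy_dual] bound the increase of the functional by
    [eta] times a quantity controlled by [M] and [Psi], plus a constant times the energy of z. First
    [eta] is fixed, then the bound on z. *)
Lemma functional_continuous (M e : R) : 0 <= M -> 0 < e ->
  exists2 dl : R, 0 < dl & forall w v, admissible w -> admissible v ->
    total_energy w <= M -> total_energy (lincomb 1 v (-1) w) <= dl ->
    functional v <= functional w + e.
Proof.
move=> M0 e0.
have Psi0 : 0 <= Psi by apply: Rintegral_ge0 => x _; exact: powR_ge0.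
pose eta := e / (2 * (M / p + Psi + 1)).
have c0 : 0 < M / p + Psi + 1 by rewrite ltr_wpDl// addr_ge0// divr_ge0// ltW.
have eta0 : 0 < eta by rewrite divr_gt0// mulr_gt0.
have [K K0 HK] := @energyD_le R n p tau p1 tau0 eta eta0.
have [L L0 HL] := @young_energy_dual R n p tau p1 tau0 eta eta0.
have b0 : 0 < K / p + L + 1 by rewrite ltr_wpDl// addr_ge0// divr_ge0// ltW.
exists (e / (2 * (K / p + L + 1))); first by rewrite divr_gt0// mulr_gt0.
move=> w v aw av wM; set z := lincomb 1 v (-1) w => zd.
have az : admissible z by exact: admissible_lincomb.
have [w1 w2 iw] := aw; have [v1 v2 iv] := av; have [z1 z2 iz] := az.
have E1 : total_energy v <= (1 + eta) * total_energy w + K * total_energy z.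
  apply: ler_Rintegral_lin => // x Dx.
  rewrite (_ : energy_at v x = energy p tau (Q x) (w.1 x + z.1 x) (w.2 x + z.2 x)).
    by apply: HK; exact: pQ.
  by rewrite /energy_at /z/= !mul1r !scale1r mulN1r scaleN1r ![w.1 x + _]addrC ![w.2 x + _]addrC !subrK.
have E2 : load v - load w <= eta * Psi + L * total_energy z.
  rewrite (_ : load v - load w = load z).
    apply: ler_Rintegral_lin => //; first exact: integrable_load.
    by move=> x Dx; rewrite (le_trans _ (HL (Q x) (z.1 x) (z.2 x) (phi x)))// ler_norm.
  by rewrite load_lincomb// mul1r mulN1r.
have E3 : eta * (M / p + Psi) <= e / 2.
  rewrite /eta invfM mulrA mulrAC ler_pdivrMr// ler_wpM2l ?lerDl// ltW// divr_gt0//.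
have E4 : (K / p + L) * total_energy z <= e / 2.
  rewrite (@le_trans _ _ ((K / p + L + 1) * (e / (2 * (K / p + L + 1)))))//.
    rewrite ler_pM ?total_energy_ge0//; first by rewrite addr_ge0// divr_ge0// ltW.
    by rewrite lerDl.
  rewrite le_eqVlt; apply/orP; left; apply/eqP; move: (b0).
  by move: (K / p + L + 1) => c c1; field; rewrite gt_eqF.
have E1' : total_energy v / p <= (1 + eta) * total_energy w / p + K / p * total_energy z.
  rewrite [K / p * _]mulrAC -mulrDl ler_pM2r ?invr_gt0//.
have E5 : eta * total_energy w / p <= eta * (M / p).
  rewrite -mulrA ler_wpM2l ?(ltW eta0)// ler_pM2r ?invr_gt0//.
rewrite /functional; move: E1' E2 E3 E4 E5.
rewrite [(1 + eta) * _]mulrDl mul1r !mulrDl !mulrDr.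
by move=> *; apply: error_budget; eassumption.
Qed.

Lemma energy_atBC w v x : energy_at (lincomb 1 w (-1) v) x = energy_at (lincomb 1 v (-1) w) x.
Proof.
rewrite /energy_at /energy /= !mul1r !mulN1r !scale1r !scaleN1r.
by rewrite distrC qnormBC.
Qed.

Lemma total_energyBC w v : total_energy (lincomb 1 w (-1) v) = total_energy (lincomb 1 v (-1) w).
Proof. by apply: eq_Rintegral => x _; rewrite energy_atBC. Qed.

Lemma admissible_qnorm w : admissible w ->
  mu.-integrable D (EFin \o (fun x => qnorm (Q x) (w.2 x) `^ p)).
Proof.
move=> [w1 w2 iw]; apply: (real_le_integrable mD _ _ iw).
  exact: measurable_qnorm_powR.
move=> x Dx; rewrite ger0_norm ?powR_ge0// /energy_at /energy lerDr.
by rewrite mulr_ge0 ?powR_ge0// ltW.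
Qed.

Lemma admissible_norm w : admissible w ->
  mu.-integrable D (EFin \o (fun x => `|w.1 x| `^ p)).
Proof.
move=> [w1 w2 iw].
apply: (real_le_integrable mD _ _ (real_integrable_lin mD tau^-1 0 iw iw)).
  by apply: (measurableT_comp (measurable_powR _)); exact: measurableT_comp.
move=> x Dx; rewrite ger0_norm ?powR_ge0// mul0r addr0 mulrC ler_pdivlMr// mulrC.
by rewrite /energy_at /energy lerDl powR_ge0.
Qed.

Lemma qnorm_le_total_energy w : admissible w ->
  (\int[mu]_(x in D) (qnorm (Q x) (w.2 x) `^ p)%:E <= (total_energy w)%:E)%E.
Proof.
move=> aw; rewrite (EFin_Rintegral mD) ?lee_fin; last exact: admissible_qnorm.
apply: le_Rintegral => //; [exact: admissible_qnorm|by case: aw|].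
by move=> x Dx; rewrite /energy_at /energy lerDr mulr_ge0 ?powR_ge0// ltW.
Qed.

Lemma norm_le_total_energy w : admissible w ->
  (\int[mu]_(x in D) (`|w.1 x| `^ p)%:E <= (tau^-1 * total_energy w)%:E)%E.
Proof.
move=> aw; rewrite (EFin_Rintegral mD) ?lee_fin; last exact: admissible_norm.
have iw : mu.-integrable D (EFin \o energy_at w) by case: aw.
have := @ler_Rintegral_lin _ _ _ mu D mD (fun x => `|w.1 x| `^ p) _ _ tau^-1 0 (admissible_norm aw) iw iw.
rewrite mul0r addr0; apply => x Dx; rewrite mul0r addr0 mulrC ler_pdivlMr// mulrC.
by rewrite /energy_at /energy lerDl powR_ge0.
Qed.

(** The hypothesis of [LpQ_fast_limit], with the factor [min 1 tau] because extracting |u|^p from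
    the energy costs [1 / tau]. *)
Definition fast_rate (k : nat) : R :=
  Num.min 1 tau * ((2^-1 ^+ k) `^ p / (2 ^ k.+1)%:R).

Lemma fast_rate_gt0 k : 0 < fast_rate k.
Proof.
by rewrite mulr_gt0 ?lt_min ?ltr01// divr_gt0 ?powR_gt0 ?exprn_gt0// ltr0n expn_gt0.
Qed.

(** [LpQ_fast_limit] is applied twice: to the vector parts with [Q], and to the scalar parts with
    the identity matrix of size 1. *)
Lemma total_energy_complete (w_ : nat -> fun_pair) : (forall k, admissible (w_ k)) ->
  (forall k, total_energy (lincomb 1 (w_ k.+1) (-1) (w_ k)) <= fast_rate k) ->
  exists2 w, admissible w & forall e : R, 0 < e -> exists N, forall k, (N <= k)%N ->
    total_energy (lincomb 1 (w_ k) (-1) w) <= e.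
Proof.
move=> aw H.
have ad k : admissible (lincomb 1 (w_ k.+1) (-1) (w_ k)) by exact: admissible_lincomb.
have r0 k : 0 <= (2^-1 ^+ k) `^ p / (2 ^ k.+1)%:R :> R.
  by rewrite divr_ge0 ?powR_ge0.
have [g mg Hg] : exists2 g, coor_measurable D g &
    forall k, (\int[mu]_(x in D) (qnorm (Q x) ((w_ k).2 x - g x) `^ p)%:E <=
      ((2 * 2^-1 ^+ k) `^ p)%:E)%E.
  apply: (LpQ_fast_limit mD mQ pQ p0); first by move=> l; case: (aw l).
  move=> l; rewrite (eq_integral (fun x => (qnorm (Q x) ((lincomb 1 (w_ l.+1) (-1) (w_ l)).2 x) `^ p)%:E)).
    rewrite (le_trans (qnorm_le_total_energy (ad l)))// lee_fin (le_trans (H l))//.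
    by rewrite /fast_rate ler_piMl// ge_min lexx.
  by move=> x _ /=; rewrite scale1r scaleN1r.
have [u mu' Hu] : exists2 u, coor_measurable D u &
    forall k, (\int[mu]_(x in D) (qnorm (1%:M : 'M[R]_1) (((w_ k).1 x)%:M - u x) `^ p)%:E <=
      ((2 * 2^-1 ^+ k) `^ p)%:E)%E.
  apply: (@LpQ_fast_limit _ _ _ _ mu D (fun=> 1%:M) p mD _ _ p0 (fun k x => ((w_ k).1 x)%:M)).
  - by move=> i j; exact: measurable_cst.
  - by move=> x _; exact: psd_scalar1.
  - move=> l i; rewrite (_ : (fun x => _) = (w_ l).1); first by case: (aw l).
    apply/funext => x; rewrite mxE [X in _ *+ X](_ : _ = 1%N) ?mulr1n//.
    by case: i => -[].
  move=> l; rewrite (eq_integral (fun x => (`|(lincomb 1 (w_ l.+1) (-1) (w_ l)).1 x| `^ p)%:E)).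
    rewrite (le_trans (norm_le_total_energy (ad l)))// lee_fin ler_pdivrMl//.
    by rewrite (le_trans (H l))// /fast_rate ler_wpM2r// ge_min lexx orbT.
  by move=> x _ /=; rewrite mul1r mulN1r -raddfB qnorm_scalar1.
pose w : fun_pair := (fun x => u x ord0 ord0, g).
have w1 : measurable_fun D w.1 by exact: mu'.
have uE x : u x = (w.1 x)%:M by rewrite /w /= [LHS]mx11_scalar; congr (_ _ _)%:M; exact: val_inj.
have mE k : measurable_fun D (energy_at (lincomb 1 (w_ k) (-1) w)).
  apply: measurable_energy_at => //; case: (aw k) => *;
    [exact: measurable_lincomb1|exact: measurable_lincomb2].
have Eint k : (\int[mu]_(x in D) (energy_at (lincomb 1 (w_ k) (-1) w) x)%:E <=
    ((tau + 1) * (2 * 2^-1 ^+ k) `^ p)%:E)%E.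
  under eq_integral do rewrite /energy_at /energy EFinD EFinM.
  case: (aw k) => w1k w2k _.
  have m1 := measurable_lincomb1 1 (-1) w1k w1.
  have mp1 : measurable_fun D (fun x => (`|(lincomb 1 (w_ k) (-1) w).1 x| `^ p)%:E).
    by apply/measurable_EFinP; apply: (measurableT_comp (measurable_powR _)); exact: measurableT_comp.
  rewrite ge0_integralD//; last 4 first.
  - by move=> x _; rewrite -EFinM lee_fin mulr_ge0 ?powR_ge0// ltW.
  - by apply: emeasurable_funM => //; exact: measurable_cst.
  - by move=> x _; rewrite lee_fin powR_ge0.
  - apply/measurable_EFinP; apply: measurable_qnorm_powR => //.
    exact: measurable_lincomb2.
  rewrite ge0_integralZl_EFin ?(ltW tau0)//.
  rewrite mulrDl mul1r EFinD EFinM leeD//.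
    apply: lee_wpmul2l; first by rewrite lee_fin ltW.
    rewrite (eq_integral (fun x => (qnorm (1%:M : 'M[R]_1) (((w_ k).1 x)%:M - u x) `^ p)%:E));
      first exact: Hu.
    move=> x _ /=.
    by rewrite [in RHS]uE -raddfB qnorm_scalar1 /= mul1r mulN1r.
  rewrite (eq_integral (fun x => (qnorm (Q x) ((w_ k).2 x - g x) `^ p)%:E)); first exact: Hg.
  by move=> x _ /=; rewrite scale1r scaleN1r.
have adw k : admissible (lincomb 1 (w_ k) (-1) w).
  case: (aw k) => w1k w2k _; split; [exact: measurable_lincomb1|exact: measurable_lincomb2|].
  apply/integrableP; split; first exact/measurable_EFinP.
  rewrite (le_lt_trans _ (ltry ((tau + 1) * (2 * 2^-1 ^+ k) `^ p)))//.
  rewrite (le_trans _ (Eint k))// le_eqVlt; apply/orP; left; apply/eqP; apply: eq_integral => x _ /=.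
  by rewrite ger0_norm// energy_at_ge0.
exists w.
  (* Finite energy of the limit comes from [w = w_ 0 - (w_ 0 - w)]. *)
  have := admissible_lincomb 1 (-1) (aw 0%N) (adw 0%N).
  congr admissible; rewrite /lincomb /=; congr pair; apply/funext => x.
    by rewrite !mul1r !mulN1r opprB addrC subrK.
  by rewrite !scale1r !scaleN1r opprB addrC subrK.
move=> e e0.
have : geometric (2 * (tau + 1)) 2^-1 @ \oo --> (0 : R).
  by apply: cvg_geometric; rewrite ger0_norm// invf_lt1// ltr1n.
move=> /cvgrPdist_lt /(_ _ e0) [N _ NP].
(* The shift ensures [k >= 1], so that [2 * 2^-1 ^+ k] is at most 1 and its p-th power does not
   exceed it. *)
exists N.+1 => k Nk; rewrite -lee_fin -(EFin_Rintegral mD); last by case: (adw k).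
rewrite (le_trans (Eint k))// lee_fin.
have := NP k (ltnW Nk); rewrite sub0r normrN => /ltW/(le_trans (ler_norm _)); apply: le_trans.
rewrite /geometric /= -mulrA mulrCA; apply: ler_wpM2l; first by rewrite addr_ge0// ltW.
apply: ge1r_powR; last exact: ltW.
rewrite mulr_gt0 ?exprn_gt0//=; case: k Nk => // k _.
by rewrite exprS mulrA divff// mul1r exprn_ile1// invf_le1// ler1n.
Qed.

Variable K : set fun_pair.
Hypothesis K0 : K !=set0.
Hypothesis KA : forall w, K w -> admissible w.
Hypothesis KL : forall a w b v, K w -> K v -> K (lincomb a w b v).

Lemma functional_infimum : exists m : R, (forall w, K w -> m <= functional w) /\
  forall e : R, 0 < e -> exists2 w, K w & functional w <= m + e.
Proof.
have [C HC] := functional_coercive.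
pose J := [set functional w | w in K].
have lJ : lbound J (- C).
  move=> _ [w Kw <-]; have := HC w (KA Kw).
  move/(le_trans (total_energy_ge0 _)).
  by rewrite pmulr_rge0 ?mulr_gt0// -lerBlDr sub0r.
have iJ : has_inf J.
  split; last by exists (- C).
  by have [w Kw] := K0; exists (functional w), w.
exists (inf J); split => [w Kw|e e0].
  by apply: ge_inf; [exact: iJ.2|exists w].
have [_ [w Kw <-] /ltW] := inf_adherent e0 iJ.
by exists w.
Qed.

(** The midpoint is a competitor, so its functional is at least [m]; the loads cancel and the
    energies have convexity defect at most [p * dl]. Uniform convexity then bounds the energy of the
    difference, half of [e] being spent on the [e1] term and half on the defect. *)
Lemma minimizing_cauchy (m e : R) : (forall w, K w -> m <= functional w) -> 0 < e ->
  exists2 dl : R, 0 < dl & forall w v, K w -> K v ->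
    functional w <= m + dl -> functional v <= m + dl ->
    total_energy (lincomb 1 w (-1) v) <= e.
Proof.
move=> mJ e0; have [C HC] := functional_coercive.
(* By coercivity, [M] bounds the energy of every competitor at level at most [m + 1]. *)
pose M := `|2 * p * (m + 1 + C)| + 1.
have M0 : 0 < M by rewrite ltr_wpDl.
pose e1 := e / (4 * M).
have e10 : 0 < e1 by rewrite divr_gt0// mulr_gt0.
have [L L0 HL] := @energy_uniform_convexity R n p tau p1 tau0 e1 e10.
pose dl := Num.min 1 (e / (2 * ((L + 1) * p))).
have L1 : 0 < L + 1 by rewrite ltr_wpDl.
have dl0 : 0 < dl by rewrite lt_min ltr01 divr_gt0// mulr_gt0// mulr_gt0.
exists dl => // w v Kw Kv Jw Jv.
have bd z : K z -> functional z <= m + dl -> total_energy z <= M.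
  move=> Kz Jz; rewrite (le_trans (HC z (KA Kz)))//.
  rewrite (@le_trans _ _ (2 * p * (m + 1 + C)))//.
    rewrite ler_pM2l ?mulr_gt0// lerD2r (le_trans Jz)// lerD2l ge_min lexx//.
  by rewrite (le_trans (ler_norm _))// lerDl.
have Kmid : K (lincomb 2^-1 w 2^-1 v) by exact: KL.
have aw := KA Kw; have av := KA Kv; have amid := KA Kmid.
have iw : mu.-integrable D (EFin \o energy_at w) by case: aw.
have iv : mu.-integrable D (EFin \o energy_at v) by case: av.
have im : mu.-integrable D (EFin \o energy_at (lincomb 2^-1 w 2^-1 v)) by case: amid.
have id : mu.-integrable D (EFin \o energy_at (lincomb 1 w (-1) v)).
  by case: (admissible_lincomb 1 (-1) aw av).
have i1 := real_integrable_lin mD 1 1 iw iv.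
have i2 := real_integrable_lin mD 2^-1 (-1) i1 im.
have H1 : total_energy (lincomb 1 w (-1) v) <= e1 * (1 * total_energy w + 1 * total_energy v) +
   L * (2^-1 * (1 * total_energy w + 1 * total_energy v) + (-1) * total_energy (lincomb 2^-1 w 2^-1 v)).
  rewrite /total_energy -[1 * _ + 1 * _](Rintegral_lin mD 1 1 iw iv).
  rewrite -(Rintegral_lin mD 2^-1 (-1) i1 im).
  apply: ler_Rintegral_lin => // x Dx.
  have := HL (Q x) (w.1 x) (v.1 x) (w.2 x) (v.2 x) (pQ Dx).
  rewrite /energy_at /= !mul1r !mulN1r !scale1r !scaleN1r -!mulrDr -!scalerDr.
  by rewrite [X in L * (X - _)]mulrC.
have H2 : (total_energy w + total_energy v) / 2 - total_energy (lincomb 2^-1 w 2^-1 v) <= p * dl.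
  apply: midpoint_budget (p0) Jw Jv _; have := mJ _ Kmid.
  by rewrite /functional load_lincomb.
have H3 : e1 * (total_energy w + total_energy v) <= e / 2.
  rewrite (@le_trans _ _ (e1 * (M + M)))//.
    by rewrite ler_wpM2l ?(ltW e10)// lerD// bd.
  rewrite le_eqVlt; apply/orP; left; apply/eqP; rewrite /e1; move: (M) M0 => M' M0.
  by field; rewrite gt_eqF.
have H4 : L * (p * dl) <= e / 2.
  rewrite mulrA (@le_trans _ _ ((L + 1) * p * dl))//.
    by rewrite ler_wpM2r ?(ltW dl0)// ler_wpM2r ?(ltW p0)// lerDl.
  rewrite mulrC -ler_pdivlMr ?mulr_gt0// /dl ge_min; apply/orP; right.
  by rewrite invfM mulrA.
exact: cauchy_budget L0 H1 H2 H3 H4.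
Qed.

(** The limit [w] need not lie in [K], so minimality passes through the infimum [m]: continuity
    gives J(w) <= m, and [w_ N + t v] belongs to [K] and approximates [w + t v], which gives m <=
    J(w + t v). *)
Lemma minimizer_exists : exists w, [/\ admissible w,
  forall e : R, 0 < e -> exists2 v, K v & total_energy (lincomb 1 w (-1) v) <= e &
  forall v (t : R), K v -> functional w <= functional (lincomb 1 w t v)].
Proof.
have [m [mJ infJ]] := functional_infimum.
have [dl dlP] : exists dl : nat -> R, forall k, 0 < dl k /\ forall w v, K w -> K v ->
    functional w <= m + dl k -> functional v <= m + dl k ->
    total_energy (lincomb 1 w (-1) v) <= fast_rate k.
  have /choice[dl dlP] : forall k : nat, exists x : R, 0 < x /\ forall w v, K w -> K v ->
    functional w <= m + x -> functional v <= m + x ->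
    total_energy (lincomb 1 w (-1) v) <= fast_rate k.
    move=> k; have [x x0 xP] := minimizing_cauchy mJ (fast_rate_gt0 k).
    by exists x.
  by exists dl.
(* The bounds [dl k] and [dl k.-1] put both [w_ k] and [w_ k.+1] below level [m + dl k]; the last
   bound makes the sequence minimizing. *)
pose ep k := Num.min (Num.min (dl k) (dl k.-1)) k.+1%:R^-1.
have ep0 k : 0 < ep k by rewrite !lt_min !(dlP _).1 invr_gt0 ltr0n.
have /choice[w_ w_P] : forall k, exists w, K w /\ functional w <= m + ep k.
  by move=> k; have [w Kw Jw] := infJ _ (ep0 k); exists w.
have Kw_ k := (w_P k).1; have aw_ k := KA (Kw_ k).
have rate k : total_energy (lincomb 1 (w_ k.+1) (-1) (w_ k)) <= fast_rate k.
  apply: (dlP k).2 => //.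
    by rewrite (le_trans (w_P k.+1).2)// lerD2l /ep !ge_min lexx !orbT.
  by rewrite (le_trans (w_P k).2)// lerD2l /ep !ge_min lexx.
have [w aw wlim] := total_energy_complete aw_ rate.
exists w; split => //.
  move=> e /wlim[N NP]; exists (w_ N) => //.
  by rewrite total_energyBC NP.
have [C HC] := functional_coercive.
move=> v t Kv; apply: (@le_trans _ _ m).
  apply/ler_addgt0Pr => e e0; have e20 : 0 < e / 2 by rewrite divr_gt0.
  pose M := `|2 * p * (m + 1 + C)|.
  have [x x0 xP] := functional_continuous (normr_ge0 (2 * p * (m + 1 + C))) e20.
  have [N NP] := wlim _ x0.
  have [k ke] := ltr_add_invr e20; rewrite add0r in ke.
  pose i := maxn N k.
  have Jwi : functional (w_ i) <= m + k.+1%:R^-1.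
    rewrite (le_trans (w_P i).2)// lerD2l /ep ge_min; apply/orP; right.
    by rewrite lef_pV2 ?posrE ?ltr0n// ler_nat ltnS leq_maxr.
  have k1 : k.+1%:R^-1 <= 1 :> R by rewrite invf_le1 ?ltr0n// ler1n.
  have := xP (w_ i) w (aw_ i) aw.
  rewrite total_energyBC => /(_ _ (NP i (leq_maxl _ _))) H.
  have {}H : functional w <= functional (w_ i) + e / 2.
    apply: H; rewrite (le_trans (HC _ (aw_ i)))// (le_trans _ (ler_norm _))//.
    by rewrite ler_pM2l ?mulr_gt0// lerD2r (le_trans Jwi)// lerD2l.
  rewrite (le_trans H)// [leRHS](_ : _ = m + e / 2 + e / 2); last by rewrite -addrA -splitr.
  by rewrite lerD2r (le_trans Jwi)// lerD2l ltW.
apply/ler_addgt0Pr => e e0.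
have av := KA Kv.
have awt : admissible (lincomb 1 w t v) by exact: admissible_lincomb.
have [x x0 xP] := functional_continuous (total_energy_ge0 (lincomb 1 w t v)) e0.
have [N NP] := wlim _ x0.
have Kwt : K (lincomb 1 (w_ N) t v) by exact: KL.
have E : lincomb 1 (lincomb 1 (w_ N) t v) (-1) (lincomb 1 w t v) = lincomb 1 (w_ N) (-1) w.
  rewrite /lincomb /=; congr pair; apply/funext => y; first by ring.
  by rewrite !scale1r !scaleN1r opprD addrACA subrr addr0.
apply: (le_trans (mJ _ Kwt)); apply: (xP _ _ awt (KA Kwt) (lexx _)).
rewrite E; exact: NP N (leqnn N).
Qed.

Definition weak_form w v : R :=
  \int[mu]_(x in D) (bil (Q x) (w.2 x) (w.2 x) `^ ((p - 2) / 2) * bil (Q x) (w.2 x) (v.2 x))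
  + tau * \int[mu]_(x in D) (`|w.1 x| `^ (p - 2) * w.1 x * v.1 x).

Lemma flux_derivative w v : admissible w -> admissible v ->
  mu.-integrable D (EFin \o (fun x =>
    bil (Q x) (w.2 x) (w.2 x) `^ ((p - 2) / 2) * bil (Q x) (w.2 x) (v.2 x))) /\
  (fun k : nat => \int[mu]_(x in D) ((qnorm (Q x) (w.2 x + k.+1%:R^-1 *: v.2 x) `^ p
     - qnorm (Q x) (w.2 x) `^ p) / k.+1%:R^-1)) @ \oo -->
    p * \int[mu]_(x in D) (bil (Q x) (w.2 x) (w.2 x) `^ ((p - 2) / 2) * bil (Q x) (w.2 x) (v.2 x)).
Proof.
move=> aw av; have [w1 w2 _] := aw; have [v1 v2 _] := av.
apply: qnorm_powR_derivative_integral => //; first exact: admissible_qnorm.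
  have := admissible_qnorm (admissible_lincomb 1 1 aw av).
  by apply: (eq_integrable mD) => x _ /=; rewrite !scale1r.
have := admissible_qnorm (admissible_lincomb 1 (-1) aw av).
by apply: (eq_integrable mD) => x _ /=; rewrite scale1r scaleN1r.
Qed.

(** The differentiation lemma for the seminorm in dimension 1 with the identity matrix, where
    <u,u>^((p-2)/2) is |u|^(p-2). *)
Lemma zero_order_derivative w v : admissible w -> admissible v ->
  mu.-integrable D (EFin \o (fun x => `|w.1 x| `^ (p - 2) * w.1 x * v.1 x)) /\
  (fun k : nat => \int[mu]_(x in D) ((`|w.1 x + k.+1%:R^-1 * v.1 x| `^ p
     - `|w.1 x| `^ p) / k.+1%:R^-1)) @ \oo -->
    p * \int[mu]_(x in D) (`|w.1 x| `^ (p - 2) * w.1 x * v.1 x).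
Proof.
move=> aw av; have [w1 w2 _] := aw; have [v1 v2 _] := av.
have mM (f : T -> R) : measurable_fun D f -> coor_measurable D (fun x => (f x)%:M : 'rV[R]_1).
  move=> mf i; rewrite (_ : (fun x => _) = f)//; apply/funext => x.
  rewrite mxE [X in _ *+ X](_ : _ = 1%N) ?mulr1n//.
  by case: i => -[].
have E1 x (k : nat) : qnorm (1%:M : 'M[R]_1) ((w.1 x)%:M + k.+1%:R^-1 *: (v.1 x)%:M) =
    `|w.1 x + k.+1%:R^-1 * v.1 x|.
  by rewrite -qnorm_scalar1 raddfD /= -scale_scalar_mx.
have E2 x : bil (1%:M : 'M[R]_1) (w.1 x)%:M (w.1 x)%:M `^ ((p - 2) / 2) *
    bil (1%:M : 'M[R]_1) (w.1 x)%:M (v.1 x)%:M = `|w.1 x| `^ (p - 2) * w.1 x * v.1 x.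
  rewrite !bil_scalar1 -mulrA; congr (_ * _).
  rewrite -expr2 -real_normK ?num_real// -powR_mulrn// -powRrM mulrC divfK//.
have E3 : (fun x => qnorm (1%:M : 'M[R]_1) (w.1 x)%:M `^ p) = (fun x => `|w.1 x| `^ p).
  by apply/funext => x; rewrite qnorm_scalar1.
have E4 : (fun x => qnorm (1%:M : 'M[R]_1) ((w.1 x)%:M + (v.1 x)%:M) `^ p) =
    (fun x => `|(lincomb 1 w 1 v).1 x| `^ p).
  by apply/funext => x; rewrite -raddfD qnorm_scalar1 /= !mul1r.
have E5 : (fun x => qnorm (1%:M : 'M[R]_1) ((w.1 x)%:M - (v.1 x)%:M) `^ p) =
    (fun x => `|(lincomb 1 w (-1) v).1 x| `^ p).
  by apply/funext => x; rewrite -raddfB qnorm_scalar1 /= mul1r mulN1r.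
have [] := @qnorm_powR_derivative_integral _ _ _ _ mu D (fun=> 1%:M) p mD
  (fun i j => measurable_cst _) (fun x _ => psd_scalar1 1) p1
  (fun x => (w.1 x)%:M) (fun x => (v.1 x)%:M) (mM _ w1) (mM _ v1).
- by rewrite E3; exact: admissible_norm.
- by rewrite E4; apply: admissible_norm; exact: admissible_lincomb.
- by rewrite E5; apply: admissible_norm; exact: admissible_lincomb.
move=> i c; split; first by apply: (eq_integrable mD) i => x _; congr (_%:E); exact: E2.
have <- : \int[mu]_(x in D) (bil (1%:M : 'M[R]_1) (w.1 x)%:M (w.1 x)%:M `^ ((p - 2) / 2) *
    bil (1%:M : 'M[R]_1) (w.1 x)%:M (v.1 x)%:M) =
    \int[mu]_(x in D) (`|w.1 x| `^ (p - 2) * w.1 x * v.1 x).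
  by apply: eq_Rintegral => x _; exact: E2.
apply: cvg_trans c; apply: near_eq_cvg; apply: nearW => k.
by apply: eq_Rintegral => x _; rewrite E1 qnorm_scalar1.
Qed.

Lemma weak_formN w v : admissible w -> admissible v ->
  weak_form w (lincomb (-1) v 0 v) = - weak_form w v.
Proof.
move=> aw av; have [i2 _] := flux_derivative aw av; have [i1 _] := zero_order_derivative aw av.
rewrite /weak_form.
rewrite (_ : \int[mu]_(x in D) (_ * bil _ _ ((lincomb (-1) v 0 v).2 x)) =
  -1 * \int[mu]_(x in D) (bil (Q x) (w.2 x) (w.2 x) `^ ((p - 2) / 2) * bil (Q x) (w.2 x) (v.2 x))).
  rewrite (_ : \int[mu]_(x in D) (_ * (lincomb (-1) v 0 v).1 x) =
    -1 * \int[mu]_(x in D) (`|w.1 x| `^ (p - 2) * w.1 x * v.1 x)).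
    by rewrite [tau * _]mulrCA -mulrDr mulN1r.
  rewrite -RintegralZl//; apply: eq_Rintegral => x _ /=.
  by rewrite mul0r addr0 mulrCA.
rewrite -RintegralZl//; apply: eq_Rintegral => x _ /=.
by rewrite scale0r addr0 bilZr mulrCA.
Qed.

Lemma total_energyE w : admissible w -> total_energy w =
  tau * \int[mu]_(x in D) (`|w.1 x| `^ p) + \int[mu]_(x in D) (qnorm (Q x) (w.2 x) `^ p).
Proof.
move=> aw; rewrite -[X in _ + X]mul1r -Rintegral_lin//.
- by apply: eq_Rintegral => x _; rewrite mul1r.
- exact: admissible_norm.
- exact: admissible_qnorm.
Qed.

Lemma Rintegral_quotient (f g : T -> R) (t : R) :
  mu.-integrable D (EFin \o f) -> mu.-integrable D (EFin \o g) ->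
  \int[mu]_(x in D) ((f x - g x) / t) =
  (\int[mu]_(x in D) f x - \int[mu]_(x in D) g x) / t.
Proof.
move=> fi gi; rewrite mulrBl ![_ / t]mulrC -mulNr -Rintegral_lin//.
by apply: eq_Rintegral => x _; rewrite mulNr mulrBl ![t^-1 * _]mulrC.
Qed.

(** The quotients of the functional along the positive steps [t = 1/(k+1)] are nonnegative, hence so
    is their limit. The reverse inequality comes from the direction -v in [euler_lagrange]. *)
Lemma euler_lagrange_ge0 w v : admissible w -> admissible v ->
  (forall t : R, functional w <= functional (lincomb 1 w t v)) ->
  0 <= weak_form w v + load v.
Proof.
move=> aw av Jmin.
have al t := admissible_lincomb 1 t aw av.
have [_ c2] := flux_derivative aw av.
have [_ c1] := zero_order_derivative aw av.
set q2 := (X in X @ \oo --> _) in c2; set q1 := (X in X @ \oo --> _) in c1.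
have cv : (fun k => (tau * q1 k + q2 k) / p + load v) @ \oo --> weak_form w v + load v.
  rewrite (_ : weak_form w v = (tau * (p * \int[mu]_(x in D) (`|w.1 x| `^ (p - 2) * w.1 x * v.1 x)) +
    p * \int[mu]_(x in D) (bil (Q x) (w.2 x) (w.2 x) `^ ((p - 2) / 2) * bil (Q x) (w.2 x) (v.2 x))) / p).
    apply: cvgD; last exact: cvg_cst.
    by apply: cvgMr_tmp; apply: cvgD => //; exact: cvgMl_tmp.
  by rewrite /weak_form mulrCA -mulrDr mulrAC divff ?gt_eqF// mul1r addrC.
rewrite -(cvg_lim _ cv)//; apply: limr_ge; first by apply/cvg_ex; eexists; exact: cv.
apply: nearW => k; set t : R := k.+1%:R^-1.
have t0 : 0 < t by rewrite invr_gt0.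
have E2 : q2 k = (\int[mu]_(x in D) (qnorm (Q x) ((lincomb 1 w t v).2 x) `^ p) -
    \int[mu]_(x in D) (qnorm (Q x) (w.2 x) `^ p)) / t.
  rewrite -Rintegral_quotient; [|exact: admissible_qnorm..].
  by apply: eq_Rintegral => x _ /=; rewrite scale1r.
have E1 : q1 k = (\int[mu]_(x in D) (`|(lincomb 1 w t v).1 x| `^ p) -
    \int[mu]_(x in D) (`|w.1 x| `^ p)) / t.
  rewrite -Rintegral_quotient; [|exact: admissible_norm..].
  by apply: eq_Rintegral => x _ /=; rewrite mul1r.
have := Jmin t; rewrite /functional load_lincomb// mul1r !total_energyE//.
rewrite E1 E2; apply: difference_quotient_ge0 => //.
Qed.

Lemma euler_lagrange w v : admissible w -> K v ->
  (forall v (t : R), K v -> functional w <= functional (lincomb 1 w t v)) ->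
  weak_form w v = - load v.
Proof.
move=> aw Kv Jmin; have av := KA Kv.
have Kv' : K (lincomb (-1) v 0 v) by exact: KL.
have := euler_lagrange_ge0 aw av (fun t => Jmin v t Kv).
have := euler_lagrange_ge0 aw (KA Kv') (fun t => Jmin _ t Kv').
rewrite weak_formN// load_lincomb// mul0r addr0 mulN1r -opprD oppr_ge0 => h1 h2.
by apply/eqP; rewrite -addr_eq0 eq_le h1 h2.
Qed.

End variational.

(** * Gradients of Lipschitz functions and the degenerate Sobolev space *)

Section operator_norm.
Context {R : realType} {n : nat}.
Implicit Types (A : 'M[R]_n) (x y : 'rV[R]_n).

Lemma qnorm1_enorm x : qnorm 1%:M x = enorm x.
Proof. by rewrite /qnorm /bil mulmx1. Qed.

Lemma inner_le_enorm x y : inner x y <= enorm x * enorm y.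
Proof.
have := ler_bil_qnorm x y (psd_scalar1 n); rewrite !qnorm1_enorm /bil mulmx1.
exact: le_trans (ler_norm _).
Qed.

(** Coordinates of a unit vector are at most 1 in absolute value. Boundedness makes the real [sup] a
    genuine supremum and not its default value. *)
Lemma op_norm_has_ubound A :
  has_ubound [set enorm (xi *m A) | xi in [set xi | enorm xi = 1]].
Proof.
exists (Num.sqrt (\sum_i (\sum_j `|A j i|) ^+ 2)) => _ [x x1 <-].
apply: ler_wsqrtr; apply: ler_sum => i _; rewrite -expr2 -real_normK ?num_real//.
apply: ler_sqr_nneg => //; rewrite mxE (le_trans (ler_norm_sum _ _ _))//.
apply: ler_sum => j _; rewrite normrM ler_piMl//.
have xx : inner x x = 1.
  have : enorm x ^+ 2 = 1 by rewrite x1 expr1n.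
  by rewrite sqr_sqrtr ?inner_ge0.
have xj : x ord0 j ^+ 2 <= 1.
  rewrite -xx /inner (bigD1 j)//= expr2 lerDl sumr_ge0// => k _.
  by rewrite -expr2 sqr_ge0.
by rewrite -(@expr_le1 _ 2) // real_normK ?num_real.
Qed.

Lemma op_norm_ge0 A : 0 <= op_norm A.
Proof.
rewrite /op_norm; set B := [set _ | _ in _].
have [[_ [x x1 _]]|B0] := pselect (B !=set0).
  apply: (@le_trans _ _ (enorm (x *m A))); first exact: sqrtr_ge0.
  by apply: ub_le_sup; [exact: op_norm_has_ubound|exists x].
(* There is no unit vector only in dimension 0, where [sup] takes its default value 0. *)
by rewrite sup_out// => -[].
Qed.

Lemma bil_le_op_norm A x : bil A x x <= op_norm A * inner x x.
Proof.
have [x0|xn0] := eqVneq (inner x x) 0.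
  by rewrite (inner_eq0 x0) /bil mul0mx !innerE !mul0mx mxE mulr0.
have xp : 0 < inner x x by rewrite lt_neqAle eq_sym xn0 inner_ge0.
have ep : 0 < enorm x by rewrite sqrtr_gt0.
have e2 : inner x x = enorm x * enorm x by rewrite -expr2 sqr_sqrtr// ltW.
pose z := (enorm x)^-1 *: x.
have z1 : enorm z = 1.
  by rewrite -qnorm1_enorm qnormZ qnorm1_enorm ger0_norm ?invr_ge0 ?(ltW ep)// mulVf// gt_eqF.
have -> : bil A x x = bil A z z * inner x x.
  by rewrite bilZl bilZr e2; field; rewrite gt_eqF.
rewrite ler_pM2r// (le_trans (inner_le_enorm _ _))// z1 mulr1.
by apply: ub_le_sup; [exact: op_norm_has_ubound|exists z].
Qed.

End operator_norm.

Section lipschitz_gradient.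
Context {R : realType} {n : nat}.
Implicit Types f g : 'rV[R]_n -> R.

Lemma grad_measurable f : lipschitz f ->
  coor_measurable ([set: 'rV[R]_n] : set (lebesgue_row R n)) (grad f).
Proof.
move=> lf i; under eq_fun do rewrite mxE; exact: measurable_partial.
Qed.

Lemma grad_derivable_ae f : lipschitz f ->
  {ae @lebesgue R n, forall x, forall i, derivable f x (delta_mx ord0 i)}.
Proof.
move=> lf.
have H (k : nat) : {ae @lebesgue R n, forall x, forall i : 'I_n,
    i = k :> nat -> derivable f x (delta_mx ord0 i)}.
  have [kn|kn] := ltnP k n; last by apply: aeW => x i ik; move: (ltn_ord i); rewrite ik ltnNge kn.
  have := @derivable_coor_ae R n f (Ordinal kn) lf.
  apply: (@filterS _ _ (ae_filter_ringOfSetsType (@lebesgue R n))).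
  move=> x H i ik.
  by rewrite (_ : i = Ordinal kn)//; exact: val_inj.
have := ae_foralln H; apply: (@filterS _ _ (ae_filter_ringOfSetsType (@lebesgue R n))).
by move=> x Hx i; exact: (Hx i).
Qed.

Lemma norm_delta_mx_le (i : 'I_n) : `|delta_mx ord0 i : 'rV[R]_n| <= 1.
Proof.
by apply: row_norm_le => // j; rewrite mxE; case: (_ && _); rewrite ?normr1 ?normr0.
Qed.

Lemma partial_bound f (L : R) x i : 0 <= L -> (forall y z, `|f y - f z| <= L * `|y - z|) ->
  derivable f x (delta_mx ord0 i) -> `|'D_(delta_mx ord0 i) f x| <= L.
Proof.
move=> L0 fL df.
have cf : (fun h : R => `|h^-1 *: ((f \o shift x) (h *: delta_mx ord0 i) - f x)|) @ 0^' -->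
    `|'D_(delta_mx ord0 i) f x| by apply: cvg_norm; exact: df.
rewrite -(cvg_lim _ cf)//; apply: limr_le; first by apply/cvg_ex; eexists; exact: cf.
near=> h; have h0 : h != 0 by near: h; exact: nbhs_dnbhs_neq.
rewrite normrZ normfV ler_pdivrMl ?normr_gt0// mulrC (le_trans (fL _ _))//=.
rewrite addrK normrZ ler_wpM2l// ler_piMr// norm_delta_mx_le.
Unshelve. all: by end_near. Qed.

Lemma grad_bound f (L : R) x : 0 <= L -> (forall y z, `|f y - f z| <= L * `|y - z|) ->
  (forall i, derivable f x (delta_mx ord0 i)) -> inner (grad f x) (grad f x) <= n%:R * L ^+ 2.
Proof.
move=> L0 fL df; rewrite /inner -[n in n%:R]card_ord -sumr_const mulr_suml.
apply: ler_sum => i _; rewrite mul1r !mxE -expr2 -real_normK ?num_real//.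
by apply: ler_sqr_nneg => //; exact: partial_bound.
Qed.

Lemma grad_lin f g (a b : R) x :
  (forall i, derivable f x (delta_mx ord0 i)) -> (forall i, derivable g x (delta_mx ord0 i)) ->
  grad (fun y => a * f y + b * g y) x = a *: grad f x + b *: grad g x.
Proof.
move=> df dg; apply/rowP => i; rewrite !mxE.
rewrite (_ : (fun y => _) = (a *: f) + (b *: g))//.
by rewrite deriveD ?deriveZ//; exact: derivableZ.
Qed.

Lemma Lip0_lin (Theta : set 'rV[R]_n) f g (a b : R) : Lip0 Theta f -> Lip0 Theta g ->
  Lip0 Theta (fun y => a * f y + b * g y).
Proof.
move=> [lf [bf cf]] [lg [bg cg]]; split; first exact: lipschitz_lin.
have sub : closure [set x | a * f x + b * g x != 0] `<=`
    closure [set x | f x != 0] `|` closure [set x | g x != 0].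
  rewrite -closureU; apply: closureS => x /=; apply: contraNP.
  by move=> /not_orP[/negP/negPn/eqP -> /negP/negPn/eqP ->]; rewrite !mulr0 addr0.
split.
  have [M [Mr Hf]] := bf; have [N [Nr Hg]] := bg.
  exists (Num.max M N); split; first exact: num_real.
  by move=> k; rewrite gt_max => /andP[Mk Nk] x /sub[]; [exact: Hf|exact: Hg].
have cc (A : set 'rV[R]_n) : closure (closure A) = closure A.
  by apply/esym/closure_id; exact: closed_closure.
by rewrite cc => x /sub[]; rewrite -cc; [exact: cf|exact: cg].
Qed.

End lipschitz_gradient.

Section lebesgue_integrability.
Context {R : realType} {n : nat}.
Implicit Types (D : set 'rV[R]_n) (f : 'rV[R]_n -> R).

Lemma closed_measurable_row D : closed D -> measurable D.
Proof.
move=> /closed_openC/open_measurable_row mD.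
by rewrite -[D]setCK; exact: measurableC.
Qed.

Lemma bounded_lebesgue_lty D : bounded_set D -> measurable (D : set (lebesgue_row R n)) ->
  (lebesgue (D : set (lebesgue_row R n)) < +oo)%E.
Proof.
move=> [M [_ DM]] mD; pose k := Num.max M 0 + 1.
have k0 : 0 < k by rewrite ltr_pwDr// le_max lexx orbT.
have Mk : M < k by rewrite /k (@le_lt_trans _ _ (Num.max M 0)) ?ltrDl// le_max lexx.
have ab (i : 'I_n) : (const_mx (- (k + 1)) : 'rV[R]_n) ord0 i <= (const_mx k : 'rV[R]_n) ord0 i.
  by rewrite !mxE; move: k0; clear; lra.
(* Boxes are open on the left, hence the margin of 1 in the lower corner. *)
apply: (@le_lt_trans _ _ (lebesgue (box (const_mx (- (k + 1))) (const_mx k) : set (lebesgue_row R n)))).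
  apply: le_measure; rewrite ?inE//; first exact: measurable_lebesgue (measurable_box _ _).
  move=> x Dx i; have := le_trans (ler_norm_coor x i) (DM _ Mk _ Dx).
  rewrite !mxE in_itv /= ler_norml => /andP[kx ->]; rewrite andbT.
  by rewrite (lt_le_trans _ kx)// ltrN2 ltrDl.
by rewrite lebesgue_box// ltry.
Qed.

Lemma mem_Lp_integrable (s : R) D f : 0 < s -> measurable (D : set (lebesgue_row R n)) ->
  mem_Lp s D f -> lebesgue.-integrable (D : set (lebesgue_row R n)) (EFin \o (fun x => `|f x| `^ s)).
Proof.
move=> s0 mD [mf fs]; apply/integrableP; split.
  apply/measurable_EFinP; apply: (measurableT_comp (measurable_powR _)).
  exact: measurableT_comp.
under eq_integral do rewrite /= ger0_norm ?powR_ge0//.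
by apply: lty_poweRy fs; rewrite invr_eq0 gt_eqF.
Qed.

Lemma lipschitz_measurable D f : lipschitz f -> measurable (D : set 'rV[R]_n) ->
  measurable_fun (D : set (lebesgue_row R n)) f.
Proof.
move=> lf mD; apply: measurable_fun_lebesgue => //.
apply: (measurable_funS measurableT) => //.
by apply: continuous_measurable_row; exact: lipschitz_continuous.
Qed.

Lemma lipschitz_integrable (s : R) D f : 0 <= s -> lipschitz f -> bounded_set D ->
  measurable (D : set 'rV[R]_n) ->
  lebesgue.-integrable (D : set (lebesgue_row R n)) (EFin \o (fun x => `|f x| `^ s)).
Proof.
move=> s0 lf bD mD; have [K K0 fK] := (lipschitzP f).1 lf.
have mD' := measurable_lebesgue mD.
apply: (measurable_bounded_integrable mD' (bounded_lebesgue_lty bD mD')).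
  apply: (measurableT_comp (measurable_powR _)); apply: (measurableT_comp (@normr_measurable _ _)).
  exact: lipschitz_measurable.
have [M [_ DM]] := bD; pose k := `|M| + 1.
have Mk : M < k by rewrite (le_lt_trans (ler_norm _))// ltrDl.
exists ((`|f 0| + K * k) `^ s); split; first exact: num_real.
move=> c /ltW + x Dx; apply: le_trans; rewrite /= ger0_norm ?powR_ge0//.
apply: ler_powR_nneg => //; rewrite -[f x](subrK (f 0)) addrC (le_trans (ler_normD _ _))//.
rewrite lerD2l (le_trans (fK _ _))// ler_wpM2l// subr0; exact: DM.
Qed.

End lebesgue_integrability.

(** * Lipschitz pairs as competitors, and the minimizer as a Sobolev pair *)

Section sobolev.
Context {R : realType} {n : nat}.
Variables (Theta : set 'rV[R]_n) (p tau : R) (Q : 'rV[R]_n -> 'M[R]_n).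
Local Notation L := (lebesgue_row R n).
Hypotheses (oT : open Theta) (bT : bounded_set Theta).
Hypothesis mQ : forall i j, measurable_fun (Theta : set L) (fun x => Q x i j).
Hypothesis pQ : forall x, Theta x -> psd (Q x).
Hypotheses (p1 : 1 < p) (tau0 : 0 < tau).
Hypothesis iQ : lebesgue.-integrable (Theta : set L) (EFin \o (fun x => op_norm (Q x) `^ (p / 2))).

Let mT : measurable (Theta : set 'rV[R]_n). Proof. exact: open_measurable_row. Qed.
Let mT' : measurable (Theta : set L). Proof. exact: measurable_lebesgue. Qed.
Let p0 : 0 < p. Proof. exact: lt_trans p1. Qed.

Lemma grad_coor_measurable f : lipschitz f -> coor_measurable (Theta : set L) (grad f).
Proof.
move=> lf i; apply: (measurable_funS measurableT (@subsetT _ _)); exact: grad_measurable.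
Qed.

(* The gradient is prescribed only almost everywhere: 'D_v is additive only
   where the partial derivatives exist. *)
Definition Lip0_pair (w : fun_pair L) : Prop :=
  exists2 f, Lip0 Theta f &
    [/\ w.1 = f, coor_measurable (Theta : set L) w.2 & {ae lebesgue, forall x : L, w.2 x = grad f x}].

Lemma Lip0_pair_grad f : Lip0 Theta f -> Lip0_pair (f, grad f).
Proof.
move=> Lf; exists f; first exact: Lf.
split; [by []|exact: grad_coor_measurable Lf.1|exact: aeW].
Qed.

Lemma Lip0_pair_nonempty : [set w | Lip0_pair w] !=set0.
Proof.
exists (cst 0, grad (cst 0)); apply: Lip0_pair_grad; split.
  by apply/lipschitzP; exists 0 => // x y; rewrite subrr normr0 mul0r.
have E : [set x : 'rV[R]_n | cst 0 x != 0 :> R] = set0.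
  by rewrite -subset0 => x /=; rewrite eqxx.
rewrite E closure0; split; last by rewrite closure0; exact: sub0set.
by exists 0; split; [exact: num_real|move=> k _ x []].
Qed.

Lemma Lip0_pair_lincomb a w b v : Lip0_pair w -> Lip0_pair v -> Lip0_pair (lincomb a w b v).
Proof.
move=> [f Lf [wf mw wG]] [g Lg [vg mv vG]].
exists (fun y => a * f y + b * g y); first exact: Lip0_lin.
split; first by rewrite /lincomb /= wf vg.
  by apply: coor_measurableD; exact: coor_measurableZ.
have df := grad_derivable_ae Lf.1; have dg := grad_derivable_ae Lg.1.
have F := ae_filter_ringOfSetsType (@lebesgue R n).
have H1 := @filterI _ _ F _ _ wG vG; have H2 := @filterI _ _ F _ _ df dg.
apply: (@filterS2 _ _ F _ _ _ _ H1 H2) => x [wx vx] [dfx dgx] /=.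
by rewrite wx vx -grad_lin.
Qed.

(** Almost everywhere |sqrt Q grad f|^p is at most (n K^2)^(p/2) |Q|_op^(p/2), where [K] is the
    Lipschitz constant for the sup norm. This is where the integrability of Q enters. *)
Lemma grad_energy_integrable f (g : L -> 'rV[R]_n) : lipschitz f ->
  coor_measurable (Theta : set L) g -> {ae lebesgue, forall x : L, g x = grad f x} ->
  lebesgue.-integrable (Theta : set L) (EFin \o (fun x => qnorm (Q x) (g x) `^ p)).
Proof.
move=> lf mg gE; have [K K0 fK] := (lipschitzP f).1 lf.
have mq := measurable_qnorm_powR mQ pQ p mT' mg.
pose c := (n%:R * K ^+ 2) `^ (p / 2).
have /integrableP[mb bI] := integrableZl mT' c iQ.
apply/integrableP; split; first exact/measurable_EFinP.
apply: le_lt_trans bI; apply: (ae_ge0_le_integral mT').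
- by move=> x _; exact: abse_ge0.
- by apply: (measurableT_comp (@abse_measurable _ _)); exact/measurable_EFinP.
- by move=> x _; exact: abse_ge0.
- exact: (measurableT_comp (@abse_measurable _ _)).
have F := ae_filter_ringOfSetsType (@lebesgue R n).
apply: (@filterS2 _ _ F _ _ _ _ gE (grad_derivable_ae lf)) => x gx dfx Tx /=.
have pQx := pQ Tx.
rewrite lee_fin !ger0_norm ?mulr_ge0 ?powR_ge0// qnorm_powR//.
have n0 : 0 <= n%:R * K ^+ 2 by rewrite mulr_ge0 ?sqr_ge0.
rewrite -powRM ?op_norm_ge0//; apply: ler_powR_nneg.
- by rewrite divr_ge0// ltW.
- exact: bil_ge0.
rewrite (le_trans (bil_le_op_norm _ _))// mulrC ler_wpM2r ?op_norm_ge0// gx.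
exact: grad_bound.
Qed.

Lemma Lip0_pair_admissible w : Lip0_pair w -> admissible lebesgue (Theta : set L) Q p tau w.
Proof.
move=> [f [lf _] [wf mw wG]]; split => //; first by rewrite wf; exact: lipschitz_measurable.
have If := lipschitz_integrable (ltW p0) lf bT mT.
have Ig := grad_energy_integrable lf mw wG.
have := real_integrable_lin mT' tau 1 If Ig.
by apply: (eq_integrable mT') => x _ /=; rewrite /energy_at /energy wf mul1r.
Qed.

Variable phi : 'rV[R]_n -> R.
Hypothesis phiL : mem_Lp (p / (p - 1)) Theta phi.

Lemma admissible_mem_Lp (w : fun_pair L) : admissible lebesgue (Theta : set L) Q p tau w ->
  mem_Lp p Theta w.1.
Proof.
move=> aw; split; first by case: aw.
apply: poweR_lty; rewrite (EFin_Rintegral mT') ?ltry//.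
exact: (admissible_norm mT' tau0 aw).
Qed.

Lemma integral_sqrt_mx (g : 'rV[R]_n -> 'rV[R]_n) :
  (\int[lebesgue]_(x in (Theta : set L)) (enorm (g x *m sqrt_mx (Q x)) `^ p)%:E =
   \int[lebesgue]_(x in (Theta : set L)) (qnorm (Q x) (g x) `^ p)%:E)%E.
Proof.
by apply: eq_integral => x; rewrite inE => Tx; rewrite enorm_sqrt_mx//; exact: pQ.
Qed.

Lemma admissible_mem_LpQ (w : fun_pair L) : admissible lebesgue (Theta : set L) Q p tau w ->
  mem_LpQ p Q Theta w.2.
Proof.
move=> aw; split; first by case: aw.
apply: poweR_lty; rewrite integral_sqrt_mx (EFin_Rintegral mT') ?ltry//.
exact: (admissible_qnorm mT' mQ pQ tau0 aw).
Qed.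

Lemma ae_eq_qnorm_integral (g h : L -> 'rV[R]_n) :
  coor_measurable (Theta : set L) g -> coor_measurable (Theta : set L) h ->
  {ae lebesgue, forall x : L, g x = h x} ->
  (\int[lebesgue]_(x in (Theta : set L)) (qnorm (Q x) (g x) `^ p)%:E =
   \int[lebesgue]_(x in (Theta : set L)) (qnorm (Q x) (h x) `^ p)%:E)%E.
Proof.
move=> mg mh gh.
have mq (k : L -> 'rV[R]_n) (mk : coor_measurable (Theta : set L) k) :
    measurable_fun (Theta : set L) (fun x => (qnorm (Q x) (k x) `^ p)%:E).
  by apply/measurable_EFinP; exact: (measurable_qnorm_powR mQ pQ p mT').
apply: (ae_eq_integral _ _ mT' (mq _ mg) (mq _ mh)).
apply: (@filterS _ _ (ae_filter_ringOfSetsType (@lebesgue R n)) _ _ _ gh) => x gx _.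
by rewrite gx.
Qed.

(** Closeness in energy is closeness in the Sobolev norm: the scalar part costs [1 / tau], the
    vector part 1, and [v.2] may be replaced by [grad f] under the integral. *)
Lemma pair_norm_le (w v : fun_pair L) f (e : R) : 0 <= e ->
  admissible lebesgue (Theta : set L) Q p tau w ->
  Lip0_pair v -> v.1 = f -> {ae lebesgue, forall x : L, v.2 x = grad f x} -> lipschitz f ->
  total_energy lebesgue (Theta : set L) Q p tau (lincomb 1 w (-1) v) <= e ->
  (pair_norm p Q Theta (w.1 \- f)%R (w.2 \- grad f)%R <= (((tau^-1 + 1) * e) `^ p^-1)%:E)%E.
Proof.
move=> e0 aw Kv vf vG lf dwv.
have adm := admissible_lincomb mT' mQ pQ p1 tau0 1 (-1) aw (Lip0_pair_admissible Kv).
have mw2 : coor_measurable (Theta : set L) w.2 by case: aw.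
have mv2 : coor_measurable (Theta : set L) v.2 by case: Kv => ? _ [].
have mG := grad_coor_measurable lf.
have I1 : (\int[lebesgue]_(x in (Theta : set L)) (`|(w.1 \- f) x| `^ p)%:E <= (tau^-1 * e)%:E)%E.
  apply: (@le_trans _ _ (tau^-1 *
    total_energy lebesgue (Theta : set L) Q p tau (lincomb 1 w (-1) v))%:E); last first.
    by rewrite lee_fin ler_wpM2l// invr_ge0 ltW.
  apply: le_trans (norm_le_total_energy mT' tau0 adm).
  rewrite (_ : (\int[_]_(_ in _) _)%E =
    (\int[lebesgue]_(x in (Theta : set L)) (`|(lincomb 1 w (-1) v).1 x| `^ p)%:E)%E);
    first exact: lexx.
  by apply: eq_integral => x _; rewrite /= mul1r mulN1r vf.
have I2 : (\int[lebesgue]_(x in (Theta : set L))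
    (enorm ((w.2 \- grad f) x *m sqrt_mx (Q x)) `^ p)%:E <= e%:E)%E.
  rewrite integral_sqrt_mx; apply: (@le_trans _ _
    (total_energy lebesgue (Theta : set L) Q p tau (lincomb 1 w (-1) v))%:E); last by rewrite lee_fin.
  apply: le_trans (qnorm_le_total_energy mT' mQ pQ tau0 adm).
  rewrite (ae_eq_qnorm_integral (h := (lincomb 1 w (-1) v).2)); first exact: lexx.
  - exact: coor_measurableB.
  - by case: adm.
  - apply: (@filterS _ _ (ae_filter_ringOfSetsType (@lebesgue R n)) _ _ _ vG) => x vx.
    by rewrite /= scale1r scaleN1r vx.
have pV : p^-1 != 0 by rewrite invr_eq0 gt_eqF.
have i0 (h : L -> R) : (0 <= \int[lebesgue]_(x in (Theta : set L)) (h x `^ p)%:E)%E.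
  by apply: integral_ge0 => x _; rewrite lee_fin powR_ge0.
rewrite /pair_norm /Lp_norm /LpQ_norm -!poweRrM mulVf ?gt_eqF// !poweRe1 ?i0//.
rewrite -poweR_EFin; apply: gt0_ler_poweR.
- by rewrite invr_ge0 ltW.
- by rewrite in_itv /= adde_ge0 ?i0//= leey.
- by rewrite in_itv /= lee_fin mulr_ge0 ?addr_ge0 ?invr_ge0 ?(ltW tau0)//= leey.
by rewrite mulrDl mul1r EFinD leeD.
Qed.

Lemma weak_solution_exists : exists u g, weak_solution p tau Q Theta phi u g.
Proof.
have p'0 : 0 < p / (p - 1) by rewrite divr_gt0// subr_gt0.
have iphi := mem_Lp_integrable p'0 mT' phiL.
have [w [aw wK wmin]] := minimizer_exists mT' mQ pQ p1 tau0 phiL.1 iphi Lip0_pair_nonempty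
  Lip0_pair_admissible Lip0_pair_lincomb.
exists w.1, w.2; split.
  split; [exact: admissible_mem_Lp|exact: admissible_mem_LpQ|move=> e e0].
  (* With this [d] the bound of [pair_norm_le] equals [e / 2], which makes the final inequality
     strict. *)
  pose d := (e / 2) `^ p / (tau^-1 + 1).
  have t0 : 0 < tau^-1 + 1 by rewrite addr_gt0// invr_gt0.
  have d0 : 0 < d by rewrite divr_gt0// powR_gt0// divr_gt0.
  have [v Kv dwv] := wK d d0; have [f Lf [vf _ vG]] := Kv; exists f => //.
  apply: le_lt_trans (pair_norm_le (ltW d0) aw Kv vf vG Lf.1 dwv) _.
  rewrite lte_fin /d mulrC divfK ?gt_eqF// -powRrM mulfV ?gt_eqF// powRr1.
    by rewrite ltr_pdivrMr// ltr_pMr// ltr1n.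
  by rewrite divr_ge0// ltW.
move=> v Lv.
exact: (euler_lagrange mT' mQ pQ p1 tau0 phiL.1 iphi Lip0_pair_admissible Lip0_pair_lincomb
  aw (Lip0_pair_grad Lv) wmin).
Qed.

End sobolev.

Unset Implicit Arguments.
Set Strict Implicit.
Set Printing Implicit Defensive.

Theorem proposition4p4 (R : realType) (n : nat) (Omega : set 'rV[R]_n)
    (p tau : R) (Q : 'rV[R]_n -> 'M[R]_n) :
  open Omega -> 1 < p -> 0 < tau ->
  (forall i j, measurable_fun (Omega : set (lebesgue_row R n))
     (fun x => Q x i j)) ->
  (forall x, Omega x -> psd (Q x)) ->
  mem_Lp_loc (p / 2) Omega (fun x => op_norm (Q x)) ->
  forall (Theta : set 'rV[R]_n) (phi : 'rV[R]_n -> R),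
    open Theta -> compactly_included Theta Omega ->
    mem_Lp (p / (p - 1)) Theta phi ->
    exists (u : 'rV[R]_n -> R) (g : 'rV[R]_n -> 'rV[R]_n),
      weak_solution p tau Q Theta phi u g.
Proof.
move=> oO p1 tau0 mQ pQ LQ Theta phi oT [bT cT] phiL.
have TO : Theta `<=` Omega by apply: subset_trans cT; exact: subset_closure.
have mO := measurable_lebesgue (open_measurable_row oO).
have mT := measurable_lebesgue (open_measurable_row oT).
have mC := measurable_lebesgue (closed_measurable_row (@closed_closure _ Theta)).
have p20 : 0 < p / 2 by rewrite divr_gt0// (lt_trans ltr01).
(* Every point of the closure is within distance 1 of [Theta], hence the bound [M + 1]. *)
have bC : bounded_set (closure Theta).
  have [M [Mr TM]] := bT; exists (M + 1); split; first exact: num_real.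
  move=> k Mk x /(_ _ (nbhsx_ballx x 1 ltr01))[y [Ty]].
  rewrite -ball_normE /= => xy.
  rewrite -[x](subrK y) (le_trans (ler_normD _ _))// -[k](subrK 1) addrC lerD ?(ltW xy)//.
  by apply: TM Ty; rewrite ltrBrDr.
have cC : compact (closure Theta).
  by apply: bounded_closed_compact => //; exact: closed_closure.
apply: (weak_solution_exists oT bT _ _ p1 tau0 _ phiL).
- by move=> i j; apply: measurable_funS (mQ i j).
- by move=> x /TO; exact: pQ.
(* Local integrability is applied on the compact closure of [Theta] and then restricted to
   [Theta]. *)
have := mem_Lp_integrable p20 mC (LQ _ cC cT).
move=> /(integrableS mC mT (@subset_closure _ _)).
by apply: (eq_integrable mT) => x _ /=; rewrite ger0_norm ?op_norm_ge0.
Qed.
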